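(* Suppose an L-shaped net of size $m\times n$ is sufficiently close to the L-shaped square net and satisfies one of the following conditions: (i) in each of its $1\times 2$ sub-nets or in each of its $2\times 1$ sub-nets, the two faces are affine symmetric with respect to their common edge (that is, either this holds for all $1\times 2$ sub-nets, or it holds for all $2\times 1$ sub-nets); (ii) each pair of its faces with a common edge has equal opposite ratios with respect to that edge. Then it is contained in exactly one deformable $m\times n$ net. Moreover, the resulting $m\times n$ net continuously depends on the given L-shaped net.
   Context: An $m\times n$ net is a collection of points $P_{ij}\in\mathbb{R}^d$, $0\le i\le m$, $0\le j\le n$ (not necessarily distinct), such that for all $0\le i<m$, $0\le j<n$ the points $P_{ij},P_{i+1,j},P_{i+1,j+1},P_{i,j+1}$ are consecutive vertices of a convex (planar, non-degenerate) quadrilateral. These quadrilaterals are the faces and their sides are the edges; faces and edges are labeled by the indices of their vertices, and a common edge of two faces must have common labels with both. An L-shaped net of size $m\times n$ is an indexed collection of $2m+2n$ points $P_{ij}$ with $0\le i\le m$, $0\le j\le n$, $\min\{i,j\}\le 1$, such that $P_{ij},P_{i+1,j},P_{i+1,j+1},P_{i,j+1}$ are consecutive vertices of a convex quadrilateral whenever $i=0$, $0\le j<n$ or $j=0$, $0\le i<m$. Edges and faces are defined as for $m\times n$ nets. An $a\times b$ sub-net is formed by the points $P_{ij}$ with $p\le i\le p+a$, $q\le j\le q+b$ for some integers $p,q\ge 0$ such that all the resulting cells are faces of the L-shaped net. An L-shaped square net is an L-shaped net whose faces are coplanar non-coincident squares. An L-shaped net is contained in an $m\times n$ net if the points with the same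 indices coincide. Two $m\times n$ nets are parallel if their corresponding edges (edges with the same indices of endpoints) are parallel. They are congruent if there is an isometry of $\mathbb{R}^d$ taking each point of the first net to the point of the second net with the same indices. An $m\times n$ net is deformable if it is contained in a continuous family of non-congruent parallel $m\times n$ nets with the same areas of corresponding faces. Two quadrilaterals in $\mathbb{R}^d$ with a common side are affine symmetric with respect to the common side if there is an affine map taking the first quadrilateral to the second one and keeping the points of the common side fixed (labels are ignored). For a convex quadrilateral $ABCD$ with diagonals meeting at $Q$, the opposite ratio of $ABCD$ with respect to the side $AB$ is $\mathrm{Area}(AQB)/\mathrm{Area}(CQD)$. *)

(* Defs.v *)
From HB Require Import structures.
From mathcomp Require Import all_boot all_order all_algebra.
From mathcomp Require Import all_classical all_reals all_analysis.

Set Implicit Arguments.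
Unset Strict Implicit.
Unset Printing Implicit Defensive.

Import Order.TTheory GRing.Theory Num.Theory.
Import numFieldNormedType.Exports.
Local Open Scope classical_set_scope.
Local Open Scope ring_scope.

Section Quadrilaterals.
Context {R : realType} {d : nat}.
Local Notation pt := 'rV[R]_d.
Implicit Types A B C D Q x y u v : pt.

(* The library norm on 'rV[R]_d is the sup norm.  It is used below only for
   topological notions; lengths, angles, areas and isometries are Euclidean. *)
Definition dot u v : R := \sum_(k < d) u 0 k * v 0 k.
Definition edist x y : R := Num.sqrt (dot (y - x) (y - x)).

Definition isometry (f : pt -> pt) : Prop :=
  forall x y, edist (f x) (f y) = edist x y.

Definition affine_map (f : pt -> pt) : Prop :=
  exists (M : 'M[R]_d) (b : pt), forall x, f x = x *m M + b.

Definition parallel_vec u v : Prop := exists2 k : R, k != 0 & v = k *: u.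

Definition collinear A B C : bool := ~~ row_free (col_mx (B - A) (C - A)).

Definition segment A B : set pt :=
  [set x | exists2 t : R, 0 <= t <= 1 & x = (1 - t) *: A + t *: B].

Definition open_segment A B : set pt :=
  [set x | exists2 t : R, 0 < t < 1 & x = (1 - t) *: A + t *: B].

(* A, B, C, D are consecutive vertices: the diagonals are AC and BD. *)
Definition convex_quad A B C D : Prop :=
  [/\ ~~ collinear A B C, ~~ collinear B C D, ~~ collinear C D A,
      ~~ collinear D A B & open_segment A C `&` open_segment B D !=set0].

Definition square A B C D : Prop :=
  [/\ convex_quad A B C D,
      [/\ edist A B = edist B C, edist B C = edist C D
        & edist C D = edist D A]
    & [/\ dot (B - A) (D - A) = 0, dot (C - B) (A - B) = 0,
          dot (D - C) (B - C) = 0 & dot (A - D) (C - D) = 0]].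

Definition area3 A B C : R :=
  Num.sqrt (dot (B - A) (B - A) * dot (C - A) (C - A)
            - dot (B - A) (C - A) ^+ 2) / 2.

(* The area of a convex quadrilateral, which is cut in two by its diagonal. *)
Definition area4 A B C D : R := area3 A B C + area3 A C D.

(* On a convex quadrilateral ABCD the set below is a singleton. *)
Definition diag_point A B C D : pt :=
  get (open_segment A C `&` open_segment B D).

Definition opposite_ratio A B C D : R :=
  let Q := diag_point A B C D in area3 A Q B / area3 C Q D.

Definition vertices A B C D : set pt := [set A; B; C; D].

(* The two relations below compare convex quadrilaterals ABCD and ABC'D' (both
   with consecutive vertices) with the common side AB. *)
Definition affine_symmetric A B C D C' D' : Prop :=
  exists f : pt -> pt,
    [/\ affine_map f, f @` vertices A B C D = vertices A B C' D'
      & forall x, segment A B x -> f x = x].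

Definition same_opposite_ratio A B C D C' D' : Prop :=
  opposite_ratio A B C D = opposite_ratio A B C' D'.

End Quadrilaterals.

(* A net is given by P : nat -> nat -> 'rV[R]_d; only the values of P at the
   indices of the net (predicates net_idx and L_idx) are meaningful, and every
   definition below depends on these values only. *)
Section Nets.
Context {R : realType} {d : nat}.
Local Notation pt := 'rV[R]_d.
Variables m n : nat.
Implicit Types P Q L S : nat -> nat -> pt.

Definition net_idx (i j : nat) : bool := ((i <= m) && (j <= n))%N.
Definition L_idx (i j : nat) : bool := (net_idx i j && (minn i j <= 1))%N.

(* The face (i, j) is the one with the vertices (i, j), (i + 1, j),
   (i + 1, j + 1), (i, j + 1). *)
Definition net_face (i j : nat) : bool := ((i < m) && (j < n))%N.
Definition L_face (i j : nat) : bool :=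
  ((i == 0) && (j < n) || (j == 0) && (i < m))%N.

Definition on_face {T : Type} (f : pt -> pt -> pt -> pt -> T) P i j : T :=
  f (P i j) (P i.+1 j) (P i.+1 j.+1) (P i j.+1).

Definition is_net P : Prop :=
  forall i j, net_face i j -> on_face convex_quad P i j.

Definition is_L_net L : Prop :=
  forall i j, L_face i j -> on_face convex_quad L i j.

Definition is_L_square_net S : Prop :=
  [/\ is_L_net S,
      forall i j, L_face i j -> on_face square S i j,
      exists (O : pt) (U : 'M[R]_(2, d)),
        forall i j, L_idx i j -> (S i j - O <= U)%MS
    & forall i j i' j', L_face i j -> L_face i' j' -> (i, j) <> (i', j') ->
        on_face vertices S i j <> on_face vertices S i' j'].

Definition L_contained L P : Prop := forall i j, L_idx i j -> P i j = L i j.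

Definition net_eq P Q : Prop := forall i j, net_idx i j -> P i j = Q i j.

Definition parallel_nets P Q : Prop :=
  (forall i j, (i < m)%N -> (j <= n)%N ->
     parallel_vec (P i.+1 j - P i j) (Q i.+1 j - Q i j)) /\
  (forall i j, (i <= m)%N -> (j < n)%N ->
     parallel_vec (P i j.+1 - P i j) (Q i j.+1 - Q i j)).

Definition congruent_nets P Q : Prop :=
  exists2 f : pt -> pt, isometry f &
    forall i j, net_idx i j -> f (P i j) = Q i j.

Definition same_areas P Q : Prop :=
  forall i j, net_face i j -> on_face area4 P i j = on_face area4 Q i j.

Definition deformable P : Prop :=
  exists F : R -> nat -> nat -> pt,
    [/\ forall t : R, t \in `[0, 1] -> is_net (F t),
        forall i j, net_idx i j ->
          {within `[0, 1], continuous (fun t : R => F t i j)},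
        forall s t : R, s \in `[0, 1] -> t \in `[0, 1] -> s != t ->
          [/\ parallel_nets (F s) (F t), ~ congruent_nets (F s) (F t)
            & same_areas (F s) (F t)]
      & exists2 t : R, t \in `[0, 1] & net_eq (F t) P].

(* rel A B C D C' D' holds for the two faces ABCD and ABC'D' of each
   1 x 2 sub-net, AB being their common edge. *)
Definition on_sub_nets12 (rel : pt -> pt -> pt -> pt -> pt -> pt -> Prop) L :=
  forall p q, L_face p q -> L_face p q.+1 ->
    rel (L p q.+1) (L p.+1 q.+1) (L p.+1 q) (L p q) (L p.+1 q.+2) (L p q.+2).

Definition on_sub_nets21 (rel : pt -> pt -> pt -> pt -> pt -> pt -> Prop) L :=
  forall p q, L_face p q -> L_face p.+1 q ->
    rel (L p.+1 q) (L p.+1 q.+1) (L p q.+1) (L p q) (L p.+2 q.+1) (L p.+2 q).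

Definition cond_affine_symmetric L : Prop :=
  on_sub_nets12 affine_symmetric L \/ on_sub_nets21 affine_symmetric L.

(* Two faces with a common edge form a 1 x 2 or a 2 x 1 sub-net. *)
Definition cond_opposite_ratios L : Prop :=
  on_sub_nets12 same_opposite_ratio L /\ on_sub_nets21 same_opposite_ratio L.

Definition L_close (e : R) L S : Prop :=
  forall i j, L_idx i j -> `|L i j - S i j| < e.

Definition net_close (e : R) P Q : Prop :=
  forall i j, net_idx i j -> `|P i j - Q i j| < e.

(* Continuity on the set X of L-shaped nets of a map from L-shaped nets to
   m x n nets. *)
Definition continuous_on_L_nets (X : set (nat -> nat -> pt))
    (Phi : (nat -> nat -> pt) -> nat -> nat -> pt) : Prop :=
  forall L0, X L0 -> forall e : R, 0 < e ->
    exists2 r : R, 0 < r &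
      forall L, X L -> L_close r L L0 -> net_close e (Phi L) (Phi L0).

End Nets.

(* Main.v *)
(* Write the fourth vertex of a convex quadrilateral ABCD as
   C = A + p (B - A) + r (D - A).  The pairs (p, r) with p, r > 0 and p + r > 1 are
   parametrized by S, T > 0 through p = S (1 + S T) / (S + T) and
   r = T (1 + S T) / (S + T).  In these terms a quadrilateral with sides parallel
   to those of ABCD has the same area if and only if its sides AB, AD, DC, BC are
   scaled by X + S Y, X - T Y, X + Y / S, X - Y / T with X^2 - Y^2 = 1.  The
   opposite ratios with respect to AB and AD are S^-2 and T^-2, and passing from
   the corner A to the corner D replaces (S, T) by (1 / S, T).  So equal opposite
   ratios of two faces mean that S (or T) is inverted from one face to the next,
   and affine symmetry means moreover that the other parameter is the same.
   Along a deformation the scales of the two edges at a corner of a face trace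
   infinitely many points of a conic, which determines (S, T).  Starting from the
   L-shaped net, this forces the same alternation of S and T on the whole net;
   conversely, for alternating S and T the hyperbolas of adjacent faces can be
   matched, which deforms the net.  Nearness to the square net is only needed for
   the new faces not to be degenerate. *)

Require Import Defs.
From HB Require Import structures.
From mathcomp Require Import all_boot all_order all_algebra.
From mathcomp Require Import all_classical all_reals all_analysis.
From mathcomp Require Import ring lra zify.
Import Order.TTheory GRing.Theory Num.Theory.
Import numFieldNormedType.Exports.
Local Open Scope classical_set_scope.
Local Open Scope ring_scope.

Set Implicit Arguments.
Unset Strict Implicit.
Unset Printing Implicit Defensive.

(** * Edge scales of one face and the hyperbola behind them *)

Section FaceScales.
Context {R : realType}.
Implicit Types S T X Y a b c d p r : R.

(** If [S] is inverted from a face to the one above it, the top scale [X + Y / S] of the first is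
    the bottom scale of the second for the same [X] and [Y], so a whole column of faces shares one
    point of the hyperbola. What remains is to match neighbouring columns: this is a single equation
    if [T] does not depend on the height, and it is automatic if [T] alternates and all columns
    share the point. A scale fixes a point of the hyperbola only up to two choices; positivity of
    the scales, a consequence of the continuity of a deformation, removes the ambiguity. The conics
    of all faces pass through (1, 1), the undeformed state, and through (-1, -1), so two further
    times already identify [S] and [T]. An L-shaped net may satisfy several conditions at once, as
    the square net does, and the rule of completion may then change between nearby nets. Continuity
    of the result therefore rests on uniqueness: all rules that apply to a net complete it in the
    same way. *)

Definition pST S T := S * (1 + S * T) / (S + T).
Definition rST S T := T * (1 + S * T) / (S + T).

(** The scales are listed in cyclic order, for the sides AB, BC, DC and AD. *)
Definition face_scale S T a b c d := exists X Y,
  [/\ X ^+ 2 - Y ^+ 2 = 1, a = X + S * Y, b = X - Y / T, c = X + Y / S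
    & d = X - T * Y].

Lemma pST_gt0 S T : 0 < S -> 0 < T -> 0 < pST S T.
Proof. by move=> S0 T0; rewrite divr_gt0 ?mulr_gt0 ?addr_gt0 ?mulr_gt0. Qed.

Lemma rST_gt0 S T : 0 < S -> 0 < T -> 0 < rST S T.
Proof. by move=> S0 T0; rewrite divr_gt0 ?mulr_gt0 ?addr_gt0 ?mulr_gt0. Qed.

Lemma pST_rST S T : 0 < S -> 0 < T -> pST S T + rST S T = 1 + S * T.
Proof. by move=> S0 T0; rewrite /pST /rST; field; rewrite gt_eqF ?addr_gt0. Qed.

Lemma pST_sq S T : 0 < S -> 0 < T ->
  S ^+ 2 = pST S T * (pST S T + rST S T - 1) / rST S T.
Proof.
move=> S0 T0; have ST0 : 0 < S * T by rewrite mulr_gt0.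
rewrite pST_rST // /pST /rST; field.
by rewrite !gt_eqF ?addr_gt0.
Qed.

Lemma rST_sq S T : 0 < S -> 0 < T ->
  T ^+ 2 = rST S T * (pST S T + rST S T - 1) / pST S T.
Proof.
move=> S0 T0; have ST0 : 0 < S * T by rewrite mulr_gt0.
rewrite pST_rST // /pST /rST; field.
by rewrite !gt_eqF ?addr_gt0.
Qed.

(** The parametrization gives S T = p + r - 1 and S / T = p / r; the product and the quotient of
    these are the squares under the roots. *)
Lemma pST_surj p r : 0 < p -> 0 < r -> 1 < p + r ->
  let S := Num.sqrt (p * (p + r - 1) / r) in
  let T := Num.sqrt (r * (p + r - 1) / p) in
  [/\ 0 < S, 0 < T, pST S T = p & rST S T = r].
Proof.
move=> p0 r0 pr1 S T; have D0 : 0 < p + r - 1 by rewrite subr_gt0.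
have s0 : 0 < p * (p + r - 1) / r by rewrite divr_gt0 ?mulr_gt0.
have t0 : 0 < r * (p + r - 1) / p by rewrite divr_gt0 ?mulr_gt0.
have S0 : 0 < S by rewrite sqrtr_gt0.
have T0 : 0 < T by rewrite sqrtr_gt0.
have S2 : S ^+ 2 = p * (p + r - 1) / r by rewrite sqr_sqrtr // ltW.
have ST : S * T = p + r - 1.
  rewrite -sqrtrM 1?ltW // [X in Num.sqrt X](_ : _ = (p + r - 1) ^+ 2).
    by rewrite sqrtr_sqr gtr0_norm.
  by field; rewrite !gt_eqF.
have TE : T = S * r / p.
  have : S * T = S * (S * r / p).
    by rewrite ST mulrA mulrA -expr2 S2; field; rewrite !gt_eqF.
  by move/(mulfI (lt0r_neq0 S0)).
split=> //; rewrite /pST /rST ST TE; field.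
all: by rewrite !gt_eqF ?addr_gt0 ?mulr_gt0.
Qed.

Lemma ST_inj S T S' T' : 0 < S -> 0 < T -> 0 < S' -> 0 < T' ->
  pST S T = pST S' T' -> rST S T = rST S' T' -> S = S' /\ T = T'.
Proof.
move=> S0 T0 S0' T0' ep er.
have := pST_sq S0 T0; rewrite ep er -pST_sq // => /eqP.
have := rST_sq S0 T0; rewrite ep er -rST_sq // => /eqP.
by rewrite !eqrXn2 ?ltW // => /eqP-> /eqP->.
Qed.

(** These are the two coordinates, in the frame (B - A, D - A), of the condition that the scaled
    paths A-B-C and A-D-C end at the same vertex. *)
Lemma face_scale_closure S T a b c d : 0 < S -> 0 < T ->
  face_scale S T a b c d ->
  a + b * (pST S T - 1) = c * pST S T /\ b * rST S T = d + c * (rST S T - 1).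
Proof.
move=> S0 T0 [X [Y [_ -> -> -> ->]]]; rewrite /pST /rST.
by split; field; rewrite !gt_eqF ?addr_gt0.
Qed.

Lemma face_scale_area S T a b c d : 0 < S -> 0 < T ->
  face_scale S T a b c d ->
  a * b * rST S T + c * d * pST S T = pST S T + rST S T.
Proof.
move=> S0 T0 [X [Y [XY -> -> -> ->]]]; rewrite -[RHS]mulr1 -XY /pST /rST.
by field; rewrite !gt_eqF ?addr_gt0.
Qed.

(** The closure equations are linear, and in the unknowns [b] and [c] their determinant is p + r - 1
    = S T, which is not 0. Hence [X] and [Y] may be solved from [a] and [d] alone; the area equation
    then reads (p + r) (X^2 - Y^2) = p + r. *)
Lemma face_scaleP S T a b c d : 0 < S -> 0 < T ->
  a + b * (pST S T - 1) = c * pST S T ->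
  b * rST S T = d + c * (rST S T - 1) ->
  a * b * rST S T + c * d * pST S T = pST S T + rST S T ->
  face_scale S T a b c d.
Proof.
move=> S0 T0 e1 e2 e3; have ST0 : 0 < S + T by rewrite addr_gt0.
have ST1 : 0 < S * T by rewrite mulr_gt0.
have pr : pST S T + rST S T - 1 != 0 by rewrite pST_rST // addrAC subrr add0r gt_eqF.
pose X := (T * a + S * d) / (S + T); pose Y := (a - d) / (S + T).
have aE : a = X + S * Y by rewrite /X /Y; field; rewrite gt_eqF.
have dE : d = X - T * Y by rewrite /X /Y; field; rewrite gt_eqF.
have f1 : a + (X - Y / T) * (pST S T - 1) = (X + Y / S) * pST S T.
  by rewrite aE /pST; field; rewrite !gt_eqF.
have f2 : (X - Y / T) * rST S T = d + (X + Y / S) * (rST S T - 1).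
  by rewrite dE /rST; field; rewrite !gt_eqF.
have bE : b = X - Y / T.
  apply/(mulIf pr)/eqP; rewrite -subr_eq0; apply/eqP.
  move: e1 e2 f1 f2; set u := X - _; set v := X + _.
  set p := pST S T; set r := rST S T => e1 e2 f1 f2.
  have g1 : (b - u) * (p - 1) = (c - v) * p by lra.
  have g2 : (b - u) * r = (c - v) * (r - 1) by lra.
  rewrite (_ : _ - _ = (b - u) * r * p - (b - u) * (p - 1) * (r - 1)); last by ring.
  by rewrite g1 g2; ring.
have cE : c = X + Y / S.
  by apply/(mulIf (lt0r_neq0 (pST_gt0 S0 T0))); rewrite -e1 -f1 bE.
exists X, Y; split=> //.
have pr0 : pST S T + rST S T != 0 by rewrite gt_eqF ?addr_gt0 ?pST_gt0 ?rST_gt0.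
apply/(mulIf pr0); rewrite mul1r -[RHS]e3 bE cE aE dE /pST /rST.
by field; rewrite !gt_eqF.
Qed.

(* On the hyperbola X^2 - Y^2 = 1 the derivative of X + S Y is S (X + Y / S),
   S times the scale of the opposite side. *)
Lemma conic_root S X Y X' Y' : 0 < S ->
  X ^+ 2 - Y ^+ 2 = 1 -> X' ^+ 2 - Y' ^+ 2 = 1 ->
  X + S * Y = X' + S * Y' -> 0 < X + Y / S -> 0 < X' + Y' / S ->
  X = X' /\ Y = Y'.
Proof.
move=> S0 c c' e o o'.
have XE : X - X' = - S * (Y - Y') by lra.
have oo : 0 < (X + Y / S + (X' + Y' / S)) * S by rewrite mulr_gt0 // addr_gt0.
have : (Y - Y') * ((X + Y / S + (X' + Y' / S)) * S) = 0.
  transitivity (- (X - X') * (X + X') + (Y - Y') * (Y + Y')).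
    by rewrite XE; field; rewrite gt_eqF.
  by transitivity (- (X ^+ 2 - Y ^+ 2) + (X' ^+ 2 - Y' ^+ 2)); [ring|lra].
move/eqP; rewrite mulf_eq0 (gt_eqF oo) orbF subr_eq0 => /eqP YE.
by split=> //; move: e; rewrite YE => /addIr.
Qed.

Lemma conic_rootN S X Y X' Y' : 0 < S ->
  X ^+ 2 - Y ^+ 2 = 1 -> X' ^+ 2 - Y' ^+ 2 = 1 ->
  X - S * Y = X' - S * Y' -> 0 < X - Y / S -> 0 < X' - Y' / S ->
  X = X' /\ Y = Y'.
Proof.
move=> S0 c c' e o o'; have [] := @conic_root S X (- Y) X' (- Y') S0.
- by rewrite sqrrN.
- by rewrite sqrrN.
- by rewrite !mulrN.
- by rewrite mulNr.
- by rewrite mulNr.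
by move=> -> /oppr_inj.
Qed.

Lemma face_scaleT S T a b c d :
  face_scale S T a b c d -> face_scale T S d c b a.
Proof.
move=> [X [Y [XY -> -> -> ->]]]; exists X, (- Y).
by rewrite sqrrN !mulrN !mulNr !opprK.
Qed.

(** Fixing one scale cuts the hyperbola by a line, and only one point of the intersection can have a
    positive opposite scale. For [b] and [c] the parameters are replaced by their inverses. *)
Lemma face_scale_eq S T a b c d a' b' c' d' : 0 < S -> 0 < T ->
  [/\ 0 < a, 0 < b, 0 < c & 0 < d] -> [/\ 0 < a', 0 < b', 0 < c' & 0 < d'] ->
  face_scale S T a b c d -> face_scale S T a' b' c' d' ->
  [|| a == a', b == b', c == c' | d == d'] ->
  [/\ a = a', b = b', c = c' & d = d'].
Proof.
move=> S0 T0 [a0 b0 c0 d0] [a0' b0' c0' d0'].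
move=> [X [Y [XY aE bE cE dE]]] [X' [Y' [XY' aE' bE' cE' dE']]]; subst.
suff E : [|| X + S * Y == X' + S * Y', X - Y / T == X' - Y' / T,
   X + Y / S == X' + Y' / S | X - T * Y == X' - T * Y'] -> X = X' /\ Y = Y'.
  by move=> /E[-> ->].
have VV (u : R) : u / S = S^-1 * u by rewrite mulrC.
have VW (u : R) : u / T = T^-1 * u by rewrite mulrC.
case/or4P => /eqP e.
- exact: conic_root S0 XY XY' e c0 c0'.
- rewrite !VW in e; apply: (conic_rootN _ XY XY' e); rewrite ?invr_gt0 ?invrK //.
    by rewrite mulrC.
  by rewrite mulrC.
- rewrite !VV in e; apply: (conic_root _ XY XY' e); rewrite ?invr_gt0 ?invrK //.
    by rewrite mulrC.
  by rewrite mulrC.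
- exact: conic_rootN T0 XY XY' e b0 b0'.
Qed.

(** Elimination of [X] and [Y] from the scales at one corner. The coefficients add up to (S + T)^2,
    so the constant term can be distributed to make every monomial vanish at (1, 1). *)
Lemma face_conic S T X Y : X ^+ 2 - Y ^+ 2 = 1 ->
  (T ^+ 2 - 1) * ((X + S * Y) ^+ 2 - 1)
  + 2 * (1 + S * T) * ((X + S * Y) * (X - T * Y) - 1)
  + (S ^+ 2 - 1) * ((X - T * Y) ^+ 2 - 1) = 0.
Proof.
move=> XY; transitivity ((S + T) ^+ 2 * (X ^+ 2 - Y ^+ 2 - 1)); first by ring.
by rewrite XY subrr mulr0.
Qed.

(* Two conics of this family have the base points (1, 1) and (-1, -1) in common,
   so two further common points with distinct squares make them equal. *)
Lemma conic_coef_unique (m n m' n' A1 B1 C1 A2 B2 C2 : R) :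
  1 + m + n != 0 -> B1 != 0 -> A1 != 0 -> B2 != 0 -> B1 != B2 ->
  (C1 + 1) ^+ 2 = (A1 + 1) * (B1 + 1) -> (C2 + 1) ^+ 2 = (A2 + 1) * (B2 + 1) ->
  m * A1 + C1 + n * B1 = 0 -> m * A2 + C2 + n * B2 = 0 ->
  m' * A1 + C1 + n' * B1 = 0 -> m' * A2 + C2 + n' * B2 = 0 ->
  m = m' /\ n = n'.
Proof.
move=> mn B10 A10 B20 B12 q1 q2 e1 e2 f1 f2.
have g1 : (m - m') * A1 = - (n - n') * B1 by lra.
have g2 : (m - m') * A2 = - (n - n') * B2 by lra.
have [mm|mm] := eqVneq m m'.
  split=> //; move: g1; rewrite mm subrr mul0r => /esym/eqP.
  by rewrite mulf_eq0 (negPf B10) orbF oppr_eq0 subr_eq0 => /eqP.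
have mm0 : m - m' != 0 by rewrite subr_eq0.
(* If m and m' differ, both triples (A, C, B) are multiples of (k, l, 1). After division by B the
   quadratic relation is linear in B, and its two distinct solutions force k = l = 1, that is 1 + m
   + n = 0. *)
exfalso; pose k := - (n - n') / (m - m'); pose l := - (m * k + n).
have A1E : A1 = k * B1 by apply/(mulfI mm0); rewrite g1 /k; field.
have A2E : A2 = k * B2 by apply/(mulfI mm0); rewrite g2 /k; field.
have C1E : C1 = l * B1 by rewrite /l; move: e1; rewrite A1E; lra.
have C2E : C2 = l * B2 by rewrite /l; move: e2; rewrite A2E; lra.
have h1 : (l ^+ 2 - k) * B1 = k + 1 - 2 * l.
  by apply/(mulIf B10); move: q1; rewrite A1E C1E; lra.
have h2 : (l ^+ 2 - k) * B2 = k + 1 - 2 * l.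
  by apply/(mulIf B20); move: q2; rewrite A2E C2E; lra.
have /eqP : (l ^+ 2 - k) * (B1 - B2) = 0 by rewrite mulrBr h1 h2 subrr.
rewrite mulf_eq0 [_ - B2 == 0]subr_eq0 (negPf B12) orbF subr_eq0 => /eqP lk.
have : (l - 1) ^+ 2 = 0 by move: h1; rewrite lk subrr mul0r -lk; lra.
move=> /eqP; rewrite sqrf_eq0 subr_eq0 => /eqP l1.
have k1 : k = 1 by rewrite -lk l1 expr1n.
by move: l1; rewrite /l k1 mulr1 => h; case/eqP: mn; lra.
Qed.

Lemma face_conic_unique S T S' T' X1 Y1 X2 Y2 X1' Y1' X2' Y2' :
  0 < S -> 0 < T -> 0 < S' -> 0 < T' ->
  X1 ^+ 2 - Y1 ^+ 2 = 1 -> X2 ^+ 2 - Y2 ^+ 2 = 1 ->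
  X1' ^+ 2 - Y1' ^+ 2 = 1 -> X2' ^+ 2 - Y2' ^+ 2 = 1 ->
  X1 + S * Y1 = X1' + S' * Y1' -> X2 + S * Y2 = X2' + S' * Y2' ->
  X1 - T * Y1 = X1' - T' * Y1' -> X2 - T * Y2 = X2' - T' * Y2' ->
  0 < X1 + S * Y1 -> 0 < X1 - T * Y1 -> 0 < X2 - T * Y2 ->
  X1 + S * Y1 != 1 -> X1 - T * Y1 != 1 -> X2 - T * Y2 != 1 ->
  X1 - T * Y1 != X2 - T * Y2 -> S = S' /\ T = T'.
Proof.
move=> S0 T0 S0' T0' c1 c2 c1' c2' a1 a2 d1 d2.
have := face_conic S T c1; have := face_conic S T c2.
have := face_conic S' T' c1'; have := face_conic S' T' c2'.
rewrite -a1 -a2 -d1 -d2.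
set a := X1 + _; set d := X1 - _; set a' := X2 + _; set d' := X2 - _.
move=> f2 f1 e2 e1 pa pd pd' na nd nd' ndd.
have sq (x y : R) : 0 < x -> 0 < y -> x != y -> x ^+ 2 - 1 != y ^+ 2 - 1.
  move=> x0 y0 xy; apply: contra xy => /eqP /addIr /eqP.
  by rewrite eqrXn2 ?ltW.
have sq1 (x : R) : 0 < x -> x != 1 -> x ^+ 2 - 1 != 0.
  by move=> x0 x1; have := sq x 1 x0 ltr01 x1; rewrite expr1n subrr.
have ST0 : 0 < 1 + S * T by rewrite addr_gt0 ?mulr_gt0.
have ST0' : 0 < 1 + S' * T' by rewrite addr_gt0 ?mulr_gt0.
(* Division by the middle coefficient brings the conics to the normal form of
   [conic_coef_unique]. *)
have sc (w u x y z v : R) : 0 < w ->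
    u * x + 2 * w * y + z * v = 0 -> u / (2 * w) * x + y + z / (2 * w) * v = 0.
  move=> w0 h; rewrite (_ : _ + _ = (u * x + 2 * w * y + z * v) / (2 * w)).
    by rewrite h mul0r.
  by field; rewrite gt_eqF.
move/(sc _ _ _ _ _ _ ST0): e1; move/(sc _ _ _ _ _ _ ST0): e2.
move/(sc _ _ _ _ _ _ ST0'): f1; move/(sc _ _ _ _ _ _ ST0'): f2.
move=> f2 f1 e2 e1.
have [] := conic_coef_unique _ (sq1 _ pd nd) (sq1 _ pa na) (sq1 _ pd' nd')
   (sq _ _ pd pd' ndd) _ _ e1 e2 f1 f2.
- rewrite (_ : _ + _ = (S + T) ^+ 2 / (2 * (1 + S * T))).
    by rewrite gt_eqF // divr_gt0 ?exprn_gt0 ?addr_gt0 ?mulr_gt0 ?ltr0n.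
  by field; rewrite gt_eqF.
- by ring.
- by ring.
set m := (T ^+ 2 - 1) / _; set n := (S ^+ 2 - 1) / _ => mE nE.
(* The parameters are recovered from 1 + 2 m = V (U + V) / (1 + U V), 1 + 2 n = U (U + V) / (1 + U
   V) and 1 - 4 m n = ((U + V) / (1 + U V))^2. *)
have TE (U V : R) : 0 < U -> 0 < V -> (V ^+ 2 - 1) / (2 * (1 + U * V)) = m ->
    (U ^+ 2 - 1) / (2 * (1 + U * V)) = n ->
    V ^+ 2 = (1 + 2 * m) ^+ 2 / (1 - 4 * m * n) /\
    U ^+ 2 = (1 + 2 * n) ^+ 2 / (1 - 4 * m * n).
  move=> U0 V0 <- <-; have UV0 : 0 < 1 + U * V by rewrite addr_gt0 ?mulr_gt0.
  have -> : 1 - 4 * ((V ^+ 2 - 1) / (2 * (1 + U * V))) *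
      ((U ^+ 2 - 1) / (2 * (1 + U * V))) = (U + V) ^+ 2 / (1 + U * V) ^+ 2.
    by field; rewrite gt_eqF.
  by split; field; rewrite !gt_eqF // addr_gt0.
have [t1 s1] := TE S T S0 T0 erefl erefl.
have [t2 s2] := TE S' T' S0' T0' (esym mE) (esym nE).
have : S ^+ 2 == S' ^+ 2 by rewrite s1 s2.
have : T ^+ 2 == T' ^+ 2 by rewrite t1 t2.
by rewrite !eqrXn2 ?ltW // => /eqP-> /eqP->.
Qed.

End FaceScales.

(** * Families of edge scales *)

Section ScaleFamilies.
Context {R : realType}.
Implicit Types (S T : nat -> nat -> R) (h v : R -> nat -> nat -> R).

(* h t i j and v t i j stand for the scales of the edges (i, j)(i + 1, j) and
   (i, j)(i, j + 1) of the t-th member of a family of parallel nets. *)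
Definition scale_family m n S T h v : Prop :=
  [/\ forall t i j, t \in `[0, 1] -> (i < m)%N -> (j <= n)%N -> 0 < h t i j,
      forall t i j, t \in `[0, 1] -> (i <= m)%N -> (j < n)%N -> 0 < v t i j,
      forall t i j, t \in `[0, 1] -> (i < m)%N -> (j < n)%N ->
        face_scale (S i j) (T i j) (h t i j) (v t i.+1 j) (h t i j.+1) (v t i j),
      exists2 t, t \in `[0, 1] &
        (forall i j, (i < m)%N -> (j <= n)%N -> h t i j = 1) /\
        (forall i j, (i <= m)%N -> (j < n)%N -> v t i j = 1)
    & forall s t, s \in `[0, 1] -> t \in `[0, 1] ->
        (forall i j, (i < m)%N -> (j <= n)%N -> h s i j = h t i j) ->
        (forall i j, (i <= m)%N -> (j < n)%N -> v s i j = v t i j) -> s = t].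

Lemma scale_familyT m n S T h v : scale_family m n S T h v ->
  scale_family n m (fun i j => T j i) (fun i j => S j i)
    (fun t i j => v t j i) (fun t i j => h t j i).
Proof.
move=> [h0 v0 hv [t t01 [ht vt]] inj]; split.
- by move=> s i j s01 lti lej; apply: v0.
- by move=> s i j s01 lei ltj; apply: h0.
- by move=> s i j s01 lti ltj; apply: face_scaleT; apply: hv.
- by exists t => //; split=> i j *; [apply: vt | apply: ht].
- by move=> s s' s01 s01' hE vE; apply: inj => // i j *; [apply: vE | apply: hE].
Qed.

Section Rigidity.
Variables (m n : nat) (S T : nat -> nat -> R) (h v : R -> nat -> nat -> R).
Hypothesis S0 : forall i j, (i < m)%N -> (j < n)%N -> 0 < S i j.
Hypothesis T0 : forall i j, (i < m)%N -> (j < n)%N -> 0 < T i j.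
Hypothesis hv : scale_family m n S T h v.

Lemma scale_pos t i j : t \in `[0, 1] -> (i < m)%N -> (j < n)%N ->
  [/\ 0 < h t i j, 0 < v t i.+1 j, 0 < h t i j.+1 & 0 < v t i j].
Proof.
have [h0 v0 _ _ _] := hv => t01 im jn.
by split; [apply: h0 => //; apply: ltnW | apply: v0 | apply: h0 |
           apply: v0 => //; apply: ltnW].
Qed.

(** A scale shared by two times forces the other three of the face by [face_scale_eq], then spreads
    through common edges to the whole net. It guarantees that different times give different points
    of a conic. *)
Lemma scale_rigid s t i j : s \in `[0, 1] -> t \in `[0, 1] ->
  (i < m)%N -> (j < n)%N ->
  (h s i j == h t i j) || (v s i j == v t i j) -> s = t.
Proof.
move=> s01 t01 im jn; have [_ _ F _ inj] := hv.
pose E i j := [/\ h s i j = h t i j, v s i.+1 j = v t i.+1 j,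
   h s i j.+1 = h t i j.+1 & v s i j = v t i j].
have Eany k l : (k < m)%N -> (l < n)%N -> [|| h s k l == h t k l,
   v s k.+1 l == v t k.+1 l, h s k l.+1 == h t k l.+1 | v s k l == v t k l] ->
   E k l.
  move=> km ln; apply: (@face_scale_eq _ (S k l) (T k l)).
  - exact: (S0 km ln).
  - exact: (T0 km ln).
  - exact: scale_pos.
  - exact: scale_pos.
  - exact: F.
  - exact: F.
have E10 k l : (k.+1 < m)%N -> (l < n)%N -> E k l <-> E k.+1 l.
  move=> km ln; split=> -[e1 e2 e3 e4]; apply: Eany => //.
  - by rewrite e2 eqxx !orbT.
  - exact: ltnW.
  - by rewrite e4 eqxx !orbT.
have E01 k l : (k < m)%N -> (l.+1 < n)%N -> E k l <-> E k l.+1.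
  move=> km ln; split=> -[e1 e2 e3 e4]; apply: Eany => //.
  - by rewrite e3 eqxx.
  - exact: ltnW.
  - by rewrite e1 eqxx !orbT.
have Ek0 k l : (k < m)%N -> (l < n)%N -> E k l <-> E 0%N l.
  move=> + ln; elim: k => [//|k IH] km.
  by rewrite -E10 //; apply: IH; apply: ltnW.
have E00 l : (0 < m)%N -> (l < n)%N -> E 0%N l <-> E 0%N 0%N.
  move=> m0; elim: l => [//|l IH] ln.
  by rewrite -E01 //; apply: IH; apply: ltnW.
have m0 : (0 < m)%N by apply: leq_ltn_trans im.
have n0 : (0 < n)%N by apply: leq_ltn_trans jn.
move=> e; have Eij : E i j by apply: Eany => //; case/orP: e => ->; rewrite ?orbT.
have Eall k l : (k < m)%N -> (l < n)%N -> E k l.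
  move=> km ln; apply/(proj2 (Ek0 _ _ km ln))/(proj2 (E00 _ m0 ln)).
  exact/(proj1 (E00 _ m0 jn))/(proj1 (Ek0 _ _ im jn)).
apply: inj => // k l.
(* A horizontal edge at height [n] is the bottom of no face; it is read as the top of the face at
   height [n.-1]. Vertical edges at [i = m] are treated likewise. *)
- move=> km; rewrite leq_eqVlt => /orP[/eqP->|ln]; last by have [] := Eall _ _ km ln.
  have ln : (n.-1 < n)%N by rewrite prednK.
  by have [_ _] := Eall _ _ km ln; rewrite prednK.
- rewrite leq_eqVlt => /orP[/eqP-> ln|km ln]; last by have [] := Eall _ _ km ln.
  have km : (m.-1 < m)%N by rewrite prednK.
  by have [_] := Eall _ _ km ln; rewrite prednK.
Qed.

End Rigidity.

(** The base time contributes only the point (1, 1) common to all conics, so two more times are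
    wanted; at most one of 0, 1/2 and 1 equals [t0]. *)
Lemma two_other_times (t0 : R) : exists t1 t2 : R,
  [/\ t1 \in `[0, 1], t2 \in `[0, 1] & [/\ t1 != t0, t2 != t0 & t1 != t2]].
Proof.
have I0 : (0 : R) \in `[0, 1] by rewrite in_itv /= lexx ler01.
have I1 : (1 : R) \in `[0, 1] by rewrite in_itv /= lexx ler01.
have I2 : (1 / 2 : R) \in `[0, 1] by rewrite in_itv /=; lra.
have n01 : (0 : R) != 1 by rewrite eq_sym oner_eq0.
have n02 : (0 : R) != 1 / 2 by apply/eqP; lra.
have n12 : (1 : R) != 1 / 2 by apply/eqP; lra.
have [<-|h0] := eqVneq 0 t0.
  by exists 1, (1 / 2); rewrite I1 I2 n12 ![_ == 0]eq_sym n01 n02.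
have [<-|h1] := eqVneq 1 t0.
  by exists 0, (1 / 2); rewrite I0 I2 n01 n02 eq_sym n12.
by exists 0, 1; rewrite I0 I1 h0 h1 n01.
Qed.

(** A face off the L-shape inherits its bottom scale from the face below and its left scale from the
    face to the left. By induction both are the scales predicted by [S] and [T], so the conics of
    (S, T) and (S', T') have enough common points to coincide. *)
Lemma scale_family_unique m n S T S' T' h v :
  (forall i j, 0 < S i j) -> (forall i j, 0 < T i j) ->
  (forall i j, (i < m)%N -> (j < n)%N -> 0 < S' i j) ->
  (forall i j, (i < m)%N -> (j < n)%N -> 0 < T' i j) ->
  (forall i j, S i j.+1 = (S i j)^-1) ->
  (forall i j, T i j.+1 = T i j) \/ (forall i j, T i.+1 j = (T i j)^-1) ->
  scale_family m n S' T' h v ->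
  (forall i j, L_face m n i j -> S' i j = S i j /\ T' i j = T i j) ->
  forall i j, (i < m)%N -> (j < n)%N -> S' i j = S i j /\ T' i j = T i j.
Proof.
move=> S0 T0 S0' T0' SV modeT hv LE.
have [_ _ F [t0 t0I [ht0 vt0]] _] := hv.
(* The equations h = X + S Y and v = X - T Y for the bottom face of column [i], solved for the point
   that serves the whole column. *)
pose X t i := (T i 0 * h t i 0 + S i 0 * v t i 0) / (S i 0 + T i 0).
pose Y t i := (h t i 0 - v t i 0) / (S i 0 + T i 0).
have ST i j : S i j + T i j != 0 by rewrite gt_eqF ?addr_gt0.
have Lrow i : (i < m)%N -> (0 < n)%N -> L_face m n i 0.
  by move=> im n0; rewrite /L_face im n0 orbT.
have Lcol j : (j < n)%N -> L_face m n 0 j by move=> jn; rewrite /L_face eqxx jn.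
have hX t i : h t i 0 = X t i + S i 0 * Y t i by rewrite /X /Y; field.
have vX t i : v t i 0 = X t i - T i 0 * Y t i by rewrite /X /Y; field.
have XY0 t i : t \in `[0, 1] -> (i < m)%N -> (0 < n)%N ->
    [/\ X t i ^+ 2 - Y t i ^+ 2 = 1, v t i.+1 0 = X t i - Y t i / T i 0
      & h t i 1 = X t i + Y t i / S i 0].
  move=> t01 im n0; have [X' [Y' [c a b d e]]] := F t i 0 t01 im n0.
  have [SE TE] := LE _ _ (Lrow i im n0); rewrite SE TE in a b d e.
  have -> : X t i = X' by rewrite /X a e; field.
  have -> : Y t i = Y' by rewrite /Y a e; field.
  by split.
(* At height 0 both sides are the scale of one edge. If [T] is constant in [j], the equation is the
   same at every height; if [T] alternates in [i], the equation at height 0 and positivity make the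
   points of the two columns equal. *)
have glue t i j : t \in `[0, 1] -> (i.+1 < m)%N -> (j < n)%N ->
    X t i - Y t i / T i j = X t i.+1 - T i.+1 j * Y t i.+1.
  move=> t01 im jn; have n0 : (0 < n)%N by apply: leq_ltn_trans jn.
  have im' : (i < m)%N by apply: ltnW.
  have [c b d] := XY0 t i t01 im' n0; have [c' b' d'] := XY0 t i.+1 t01 im n0.
  have m0 : X t i - Y t i / T i 0 = X t i.+1 - T i.+1 0 * Y t i.+1.
    by rewrite -b -vX.
  case: modeT => [TE|TV].
    have TE0 k l : T k l = T k 0 by elim: l => // l <-.
    by rewrite !(TE0 _ j).
  have [|||-> ->] := conic_rootN (T0 i.+1 0) c c'.
  - by rewrite -m0 TV mulrC.
  - rewrite TV invrK mulrC -vX.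
    by have [] := scale_pos hv t01 im' n0.
  - by rewrite -b'; have [] := scale_pos hv t01 im n0.
  by rewrite TV mulrC.
suff K i j : (i < m)%N -> (j < n)%N -> [/\ S' i j = S i j, T' i j = T i j
    & forall t, t \in `[0, 1] -> h t i j = X t i + S i j * Y t i /\
                                 v t i j = X t i - T i j * Y t i].
  by move=> i j im jn; have [] := K i j im jn.
elim: i j => [|i IHi] j im; elim: j => [|j IHj] jn.
- by have [-> ->] := LE _ _ (Lrow 0%N im jn); split.
- have jn' : (j < n)%N by apply: ltnW.
  have n0 : (0 < n)%N by apply: leq_ltn_trans jn.
  have [SE TE hvE] := IHj jn'; have [SE' TE'] := LE _ _ (Lcol _ jn).
  split=> // t t01; have [hE vE] := hvE t t01.
  have [c _ _] := XY0 t 0%N t01 im n0.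
  have [X1 [Y1 [c1 a1 b1 d1 e1]]] := F t _ _ t01 im jn'.
  have [X2 [Y2 [c2 a2 b2 d2 e2]]] := F t _ _ t01 im jn.
  have [p1 p2 p3 p4] := scale_pos hv t01 im jn'.
  have [q1 q2 q3 q4] := scale_pos hv t01 im jn.
  have hE' : h t 0 j.+1 = X t 0 + S 0 j.+1 * Y t 0.
    have e : X1 = X t 0 /\ Y1 = Y t 0.
      have XE : X1 = X t 0.
        transitivity ((T 0 j * h t 0 j + S 0 j * v t 0 j) / (S 0 j + T 0 j)).
          by rewrite a1 e1 SE TE; field.
        by rewrite hE vE; field.
      split=> //; move: a1; rewrite hE XE SE => /addrI /esym.
      by move/(mulfI (lt0r_neq0 (S0 0%N j))).
    by rewrite d1 SE SV mulrC; case: e => -> ->.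
  (* On the left boundary no neighbour supplies the left scale; the bottom scale and the positivity
     of the top scale select the point instead. *)
  split=> //; have [|||e1' e2'] := conic_root (S0 0%N j.+1) c2 c.
  - by rewrite -hE' a2 SE'.
  - by rewrite -SE' -d2.
  - by rewrite SV invrK mulrC -hE.
  by rewrite e2 TE' e1' e2'.
- have [-> ->] := LE _ _ (Lrow _ im jn); split=> // t t01; exact: (conj (hX _ _) (vX _ _)).
- have jn' : (j < n)%N by apply: ltnW.
  have im' : (i < m)%N by apply: ltnW.
  have n0 : (0 < n)%N by apply: leq_ltn_trans jn.
  have [SE TE hvE] := IHj jn'; have [SEi TEi hvEi] := IHi j.+1 im' jn.
  have topE A B t k l : t \in `[0, 1] -> (k < m)%N -> (l < n)%N ->
      S' k l = S k l -> T' k l = T k l ->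
      h t k l = A + S k l * B -> v t k l = A - T k l * B ->
      v t k.+1 l = A - B / T k l /\ h t k l.+1 = A + B / S k l.
    move=> t01 km ln SEk TEk hE vE.
    have [X1 [Y1 [c1 a1 b1 d1 e1]]] := F t _ _ t01 km ln.
    have XE : X1 = A.
      transitivity ((T k l * h t k l + S k l * v t k l) / (S k l + T k l)).
        by rewrite a1 e1 SEk TEk; field.
      by rewrite hE vE; field.
    have YE : Y1 = B.
      move: a1; rewrite hE XE SEk => /addrI /esym.
      by move/(mulfI (lt0r_neq0 (S0 k l))).
    by rewrite b1 d1 XE YE SEk TEk.
  have hvN t : t \in `[0, 1] -> h t i.+1 j.+1 = X t i.+1 + S i.+1 j.+1 * Y t i.+1 /\
                               v t i.+1 j.+1 = X t i.+1 - T i.+1 j.+1 * Y t i.+1.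
    move=> t01; have [hE vE] := hvE t t01; have [hEi vEi] := hvEi t t01.
    have [_ ->] := topE _ _ t _ _ t01 im jn' SE TE hE vE.
    have [-> _] := topE _ _ t _ _ t01 im' jn SEi TEi hEi vEi.
    by rewrite SV mulrC glue.
  suff [SE' TE'] : S i.+1 j.+1 = S' i.+1 j.+1 /\ T i.+1 j.+1 = T' i.+1 j.+1.
    by split=> // t t01; exact: hvN.
  have [t1 [t2 [t1I t2I [t10 t20 t12]]]] := two_other_times t0.
  (* Since all scales are 1 at [t0], rigidity keeps the two new points off the base points and apart
     from each other. *)
  have rig s t : s \in `[0, 1] -> t \in `[0, 1] -> s != t ->
      h s i.+1 j.+1 != h t i.+1 j.+1 /\ v s i.+1 j.+1 != v t i.+1 j.+1.
    move=> s01 t01 st; split; apply: contra st => e; apply/eqP.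
      by apply: (scale_rigid S0' T0' hv s01 t01 im jn); rewrite e.
    by apply: (scale_rigid S0' T0' hv s01 t01 im jn); rewrite e orbT.
  have [X1 [Y1 [c1 a1 b1 d1 e1]]] := F t1 _ _ t1I im jn.
  have [X2 [Y2 [c2 a2 b2 d2 e2]]] := F t2 _ _ t2I im jn.
  have [k1 _ _] := XY0 t1 _ t1I im n0; have [k2 _ _] := XY0 t2 _ t2I im n0.
  have [h1 v1] := hvN _ t1I; have [h2 v2] := hvN _ t2I.
  have [p1 _ _ p4] := scale_pos hv t1I im jn.
  have [q1 _ _ q4] := scale_pos hv t2I im jn.
  have [r1 r2] := rig _ _ t1I t0I t10; have [_ r3] := rig _ _ t2I t0I t20.
  have [_ r4] := rig _ _ t1I t2I t12.
  rewrite ht0 ?vt0 // 1?ltnW // in r1 r2 r3.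
  apply: (face_conic_unique (S0 _ _) (T0 _ _) (S0' _ _ im jn) (T0' _ _ im jn)
    k1 k2 c1 c2); by rewrite -?h1 -?h2 -?v1 -?v2.
Qed.

End ScaleFamilies.

(** * Parametrized hyperbola and existence of scale families *)

Section ScaleFamilyExistence.
Context {R : realType}.
Implicit Types (f g : R -> R) (z w : R).

(** The rational parametrization of the hyperbola by z = X + Y, with X - Y = 1 / z; the undeformed
    state is z = 1. *)
Definition hypX z : R := (z + z^-1) / 2.
Definition hypY z : R := (z - z^-1) / 2.

Lemma hypXY z : z != 0 -> hypX z ^+ 2 - hypY z ^+ 2 = 1.
Proof. by move=> z0; rewrite /hypX /hypY; field. Qed.

Lemma hypX1 : hypX 1 = 1. Proof. by rewrite /hypX invr1; field. Qed.

Lemma hypY1 : hypY 1 = 0. Proof. by rewrite /hypY invr1 subrr mul0r. Qed.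

Lemma continuous_hypX z : z != 0 -> {for z, continuous hypX}.
Proof.
move=> z0; apply: cvgM; last exact: cvg_cst.
by apply: cvgD; [exact: cvg_id | apply: cvgV => //; exact: cvg_id].
Qed.

Lemma continuous_hypY z : z != 0 -> {for z, continuous hypY}.
Proof.
move=> z0; apply: cvgM; last exact: cvg_cst.
by apply: cvgB; [exact: cvg_id | apply: cvgV => //; exact: cvg_id].
Qed.

Lemma near1_cvg f (P : set R) :
  {for (1 : R), continuous f} -> f 1 = 1 -> (\forall z \near (1 : R), P z) ->
  \forall z \near (1 : R), P (f z).
Proof. by move=> fc f1 P1; apply: fc; rewrite f1. Qed.

Lemma near1_continuous_comp f g : f 1 = 1 ->
  (\forall z \near (1 : R), {for z, continuous f}) ->
  (\forall z \near (1 : R), {for z, continuous g}) ->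
  \forall z \near (1 : R), {for z, continuous (g \o f)}.
Proof.
move=> f1 fc gc.
have gfc := near1_cvg (nbhs_singleton fc) f1 gc.
near=> z; apply: continuous_comp; first by near: z.
by near: z.
Unshelve. all: by end_near.
Qed.

Lemma near1_neq0 : \forall z \near (1 : R), z != 0.
Proof. exact: (@cvgr_neq0 _ R _ (nbhs (1 : R)) _ id 1 cvg_id (oner_neq0 _)). Qed.

Variables (a b : R).
Hypothesis (b0 : 0 < b).

(* The parameter z of a face whose left edge, with coefficient b, is the right
   edge, with coefficient a, of a face with parameter w. *)
Definition next_scale w : R :=
  let x := hypX w - hypY w / a in
  (1 + b) / (x + Num.sqrt (x ^+ 2 - 1 + b ^+ 2)).

(** The unknown u = 1 / z satisfies (1 + b) u^2 - 2 x u + (1 - b) = 0. Solving for u rather than z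
    avoids a degenerate leading coefficient at b = 1, and as b > 0 the plus sign is the branch
    through 1. *)
Lemma next_scale1 : next_scale 1 = 1.
Proof.
rewrite /next_scale hypX1 hypY1 mul0r subr0 expr1n subrr add0r.
by rewrite sqrtr_sqr gtr0_norm // divff // gt_eqF // addr_gt0.
Qed.

Lemma continuous_right_scale z : z != 0 ->
  {for z, continuous (fun w => hypX w - hypY w / a)}.
Proof.
move=> z0; apply: cvgB; first exact: continuous_hypX.
by apply: cvgM; [exact: continuous_hypY | exact: cvg_cst].
Qed.

Lemma near1_right_scale_gt0 : \forall z \near (1 : R), 0 < hypX z - hypY z / a.
Proof.
have := continuous_right_scale (oner_neq0 _); rewrite /prop_for /continuous_at.
by move/cvgr_gt; apply; rewrite hypX1 hypY1 mul0r subr0.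
Qed.

Lemma near1_continuous_next_scale :
  \forall z \near (1 : R), {for z, continuous next_scale}.
Proof.
near=> z.
have z0 : z != 0 by near: z; exact: near1_neq0.
have x0 : 0 < hypX z - hypY z / a by near: z; exact: near1_right_scale_gt0.
have cx := continuous_right_scale z0.
apply: cvgM; first exact: cvg_cst.
apply: cvgV; first by rewrite gt_eqF // ltr_wpDr // sqrtr_ge0.
apply: cvgD; first exact: cx.
apply: continuous_comp; last exact: sqrt_continuous.
apply: cvgD; last exact: cvg_cst.
apply: cvgB; last exact: cvg_cst.
by apply: cvgM; exact: cx.
Unshelve. all: by end_near.
Qed.

Lemma near1_next_scale : \forall z \near (1 : R),
  hypX z - hypY z / a = hypX (next_scale z) - b * hypY (next_scale z).
Proof.
(* The radicand tends to b^2 > 0, so near 1 the square root is a genuine one. *)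
have cy : (hypX z - hypY z / a) ^+ 2 - 1 + b ^+ 2 @[z --> (1 : R)]
    --> 1 * 1 - 1 + b ^+ 2.
  have := continuous_right_scale (oner_neq0 R); rewrite /prop_for /continuous_at.
  rewrite hypX1 hypY1 mul0r subr0 => cx.
  apply: cvgD; last exact: cvg_cst.
  by apply: cvgB; [exact: (cvgM cx cx)|exact: cvg_cst].
near=> z.
have x0 : 0 < hypX z - hypY z / a by near: z; exact: near1_right_scale_gt0.
have y0 : 0 < (hypX z - hypY z / a) ^+ 2 - 1 + b ^+ 2.
  by near: z; move/cvgr_gt: cy; apply; rewrite mulr1 subrr add0r exprn_gt0.
rewrite /next_scale; set x := hypX z - _ in x0 y0 *.
set y := Num.sqrt _; have yy : y ^+ 2 = x ^+ 2 - 1 + b ^+ 2 by rewrite sqr_sqrtr // ltW.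
have xy : 0 < x + y by rewrite ltr_wpDr // sqrtr_ge0.
rewrite /hypX /hypY invf_div.
apply: (@mulfI _ (2 * (x + y))); first by rewrite mulf_neq0 ?gt_eqF.
transitivity ((1 + b) * (1 - b) + (x + y) ^+ 2); last first.
  by field; rewrite !gt_eqF // addr_gt0.
transitivity (x ^+ 2 + 2 * x * y + y ^+ 2 + (x ^+ 2 - y ^+ 2)); first by ring.
by rewrite [in X in _ + X]yy; ring.
Unshelve. all: by end_near.
Qed.

End ScaleFamilyExistence.

(** [zeta i] expresses the parameter of column [i] through that of column 0. If [T] alternates all
    columns share it; if [T] is constant in [j], each column is obtained from the previous one by
    [next_scale], and one height decides for all. *)
Lemma scale_parameters (R : realType) (T : nat -> nat -> R) :
  (forall i j, 0 < T i j) ->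
  (forall i j, T i j.+1 = T i j) \/ (forall i j, T i.+1 j = (T i j)^-1) ->
  exists zeta : nat -> R -> R,
  [/\ zeta 0 = id, forall i, zeta i 1 = 1,
      forall i, \forall z \near (1 : R), {for z, continuous (zeta i)}
    & forall i j, \forall z \near (1 : R),
        hypX (zeta i z) - hypY (zeta i z) / T i j
        = hypX (zeta i.+1 z) - T i.+1 j * hypY (zeta i.+1 z)].
Proof.
move=> T0 [TE|TV]; last first.
  exists (fun _ => id); split=> // i; last first.
    by move=> j; near=> z; rewrite TV mulrC.
  by near=> z; exact: cvg_id.
pose zeta := fix zeta i : R -> R := if i is k.+1
  then next_scale (T k 0) (T k.+1 0) \o zeta k else id.
have z1 i : zeta i 1 = 1 by elim: i => //= i ->; exact: next_scale1.
have zc i : \forall z \near (1 : R), {for z, continuous (zeta i)}.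
  elim: i => [|i IH]; first by near=> z; exact: cvg_id.
  apply: (near1_continuous_comp (z1 i) IH).
  exact: near1_continuous_next_scale.
exists zeta; split=> // i j.
have TE0 k : T k j = T k 0 by elim: j => // j <-.
rewrite !TE0; exact: (near1_cvg (nbhs_singleton (zc i)) (z1 i)
  (near1_next_scale _ (T0 i.+1 0%N))).
Unshelve. all: by end_near.
Qed.

Lemma scale_family_exists (R : realType) m n (S T : nat -> nat -> R) :
  (0 < m)%N -> (0 < n)%N ->
  (forall i j, 0 < S i j) -> (forall i j, 0 < T i j) ->
  (forall i j, S i j.+1 = (S i j)^-1) ->
  (forall i j, T i j.+1 = T i j) \/ (forall i j, T i.+1 j = (T i j)^-1) ->
  exists h v : R -> nat -> nat -> R,
  [/\ scale_family m n S T h v,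
      forall i j, (i < m)%N -> (j <= n)%N ->
        {within `[0, 1], continuous (fun t => h t i j)}
    & forall i j, (i <= m)%N -> (j < n)%N ->
        {within `[0, 1], continuous (fun t => v t i j)}].
Proof.
move=> m0 n0 S0 T0 SV modeT.
have [zeta [zid z1 zc zglue]] := scale_parameters T0 modeT.
have ch i (c : R) : \forall z \near (1 : R), {for z, continuous
    (fun w => hypX (zeta i w) + c * hypY (zeta i w))}.
  have znz := near1_cvg (nbhs_singleton (zc i)) (z1 i) near1_neq0.
  near=> z; have z0 : zeta i z != 0 by near: z.
  have cz : {for z, continuous (zeta i)} by near: z; exact: zc.
  apply: cvgD; first exact: (continuous_comp cz (continuous_hypX z0)).
  apply: cvgM; first exact: cvg_cst.
  exact: (continuous_comp cz (continuous_hypY z0)).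
have ph i (c : R) : \forall z \near (1 : R), 0 < hypX (zeta i z) + c * hypY (zeta i z).
  have := nbhs_singleton (ch i c); rewrite /prop_for /continuous_at.
  by move/cvgr_gt; apply; rewrite z1 hypX1 hypY1 mulr0 addr0.
(* Ordinals make the conditions finite in number, so that one neighbourhood of 1 serves them all. *)
pose good z (i : 'I_m.+1) (j : 'I_n.+1) :=
  [/\ zeta i z != 0, hypX (zeta i z) - hypY (zeta i z) / T i j
        = hypX (zeta i.+1 z) - T i.+1 j * hypY (zeta i.+1 z),
     0 < hypX (zeta i z) + S i j * hypY (zeta i z),
     0 < hypX (zeta i z) - T i j * hypY (zeta i z)
   & {for z, continuous (fun w => hypX (zeta i w) + S i j * hypY (zeta i w))} /\
     {for z, continuous (fun w => hypX (zeta i w) - T i j * hypY (zeta i w))}].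
have mN i (c : R) : (fun w => hypX (zeta i w) - c * hypY (zeta i w)) =
    (fun w => hypX (zeta i w) + (- c) * hypY (zeta i w)).
  by apply/funext => w; rewrite mulNr.
have goodP i j : \forall z \near (1 : R), good z i j.
  have znz := near1_cvg (nbhs_singleton (zc i)) (z1 i) near1_neq0.
  have chN := ch i (- T i j); have phN := ph i (- T i j).
  near=> z; split.
  - by near: z.
  - by near: z; exact: zglue.
  - by near: z; exact: ph.
  - by rewrite -mulNr; near: z.
  - by split; [|rewrite mN]; near: z; [exact: ch | exact: chN].
have /nbhs_ballP[e /= e0 eb] : \forall z \near (1 : R), forall i j, good z i j.
  apply: (@filter_forall _ _ (fun i z => forall j, good z i j) (nbhs (1 : R)) _) => i.
  apply: (@filter_forall _ _ (fun j z => good z i j) (nbhs (1 : R)) _) => j.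
  exact: goodP.
(* Time runs injectively into the ball of radius [e] about 1 and starts at the undeformed state. *)
pose w (t : R) := 1 + e / 2 * t.
have wgood t i j : t \in `[0, 1] -> (i <= m)%N -> (j <= n)%N ->
  [/\ zeta i (w t) != 0, hypX (zeta i (w t)) - hypY (zeta i (w t)) / T i j
        = hypX (zeta i.+1 (w t)) - T i.+1 j * hypY (zeta i.+1 (w t)),
     0 < hypX (zeta i (w t)) + S i j * hypY (zeta i (w t)),
     0 < hypX (zeta i (w t)) - T i j * hypY (zeta i (w t))
   & {for w t, continuous (fun w => hypX (zeta i w) + S i j * hypY (zeta i w))} /\
     {for w t, continuous (fun w => hypX (zeta i w) - T i j * hypY (zeta i w))}].
  rewrite in_itv /= => /andP[t0 t1] im jn.
  have /eb : ball (1 : R) e (w t).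
    rewrite /ball /= opprD addrA subrr add0r normrN ger0_norm.
      by rewrite (@le_lt_trans _ _ (e / 2)) ?ler_piMr //; lra.
    by rewrite mulr_ge0 //; lra.
  move=> /(_ (Ordinal (im : i < m.+1)%N) (Ordinal (jn : j < n.+1)%N)).
  by [].
pose h t i j := hypX (zeta i (w t)) + S i j * hypY (zeta i (w t)).
pose v t i j := hypX (zeta i (w t)) - T i j * hypY (zeta i (w t)).
have wc t : {for t, continuous w}.
  by apply: cvgD; [exact: cvg_cst | apply: cvgM; [exact: cvg_cst | exact: cvg_id]].
exists h, v; split; last first.
- move=> i j im jn; apply: continuous_in_subspaceT => t; rewrite inE => tI.
  have [_ _ _ _ [_ c]] := wgood t i j tI im (ltnW jn).
  exact: (continuous_comp (wc t) c).
- move=> i j im jn; apply: continuous_in_subspaceT => t; rewrite inE => tI.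
  have [_ _ _ _ [c _]] := wgood t i j tI (ltnW im) jn.
  exact: (continuous_comp (wc t) c).
split.
- by move=> t i j tI im jn; have [] := wgood t i j tI (ltnW im) jn.
- by move=> t i j tI im jn; have [] := wgood t i j tI im (ltnW jn).
- move=> t i j tI im jn; exists (hypX (zeta i (w t))), (hypY (zeta i (w t))).
  have [z0 g _ _ _] := wgood t i j tI (ltnW im) (ltnW jn).
  split=> //; first exact: hypXY.
  by rewrite /h SV mulrC.
- exists 0; first by rewrite in_itv /= lexx ler01.
  rewrite /h /v /w mulr0 addr0.
  by split=> i j _ _; rewrite z1 hypX1 hypY1 mulr0 ?addr0 ?subr0.
- move=> s t sI tI hE vE.
  (* The parameter of column 0 is [w t] itself, so the two scales at the corner of face (0, 0)
     determine [t]. *)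
  have := hE 0%N 0%N m0 (leq0n _); have := vE 0%N 0%N (leq0n _) n0.
  rewrite /h /v zid /= => vE0 hE0.
  have ST : S 0%N 0%N + T 0%N 0%N != 0 by rewrite gt_eqF ?addr_gt0.
  have YE : hypY (w s) = hypY (w t).
    apply: (mulfI ST); lra.
  have XE : hypX (w s) = hypX (w t) by move: hE0; rewrite YE => /addIr.
  have zE (z : R) : z = hypX z + hypY z by rewrite /hypX /hypY; lra.
  have : w s = w t by rewrite (zE (w s)) (zE (w t)) XE YE.
  by move=> /addrI /mulfI; apply; rewrite gt_eqF // divr_gt0.
Unshelve. all: by end_near.
Qed.

(** * Quadrilaterals *)

Section PlaneGeometry.
Context {R : realType} {d : nat}.
Local Notation pt := 'rV[R]_d.
Implicit Types A B C D e f u v w x y : pt.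

Lemma dotC u v : dot u v = dot v u.
Proof. by apply: eq_bigr => k _; rewrite mulrC. Qed.

Lemma dotDl u v w : dot (u + v) w = dot u w + dot v w.
Proof. by rewrite -big_split; apply: eq_bigr => k _; rewrite mxE mulrDl. Qed.

Lemma dotZl (a : R) u w : dot (a *: u) w = a * dot u w.
Proof. by rewrite mulr_sumr; apply: eq_bigr => k _; rewrite mxE mulrA. Qed.

Lemma dotDr u v w : dot w (u + v) = dot w u + dot w v.
Proof. by rewrite ![dot w _]dotC dotDl. Qed.

Lemma dotZr (a : R) u w : dot w (a *: u) = a * dot w u.
Proof. by rewrite ![dot w _]dotC dotZl. Qed.

Lemma dotNl u w : dot (- u) w = - dot u w.
Proof. by rewrite -scaleN1r dotZl mulN1r. Qed.

Lemma dotNr u w : dot w (- u) = - dot w u.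
Proof. by rewrite ![dot w _]dotC dotNl. Qed.

Lemma dot0l w : dot 0 w = 0.
Proof. by rewrite -(scale0r 0) dotZl mul0r. Qed.

Definition dotE := (dotDl, dotDr, dotZl, dotZr, dotNl, dotNr).

Lemma dot_ge0 u : 0 <= dot u u.
Proof. by apply: sumr_ge0 => k _; rewrite -expr2 sqr_ge0. Qed.

Lemma dot_eq0 u : (dot u u == 0) = (u == 0).
Proof.
apply/eqP/eqP => [h|->]; last by rewrite dot0l.
apply/rowP => k; rewrite mxE; apply/eqP; rewrite -sqrf_eq0 expr2; apply/eqP.
by move: k isT; apply: psumr_eq0P h => k _; rewrite -expr2 sqr_ge0.
Qed.

Lemma dot_gt0 u : (0 < dot u u) = (u != 0).
Proof. by rewrite lt_def dot_ge0 andbT dot_eq0. Qed.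

(** The squared area of the parallelogram spanned by [u] and [v]. *)
Definition gram u v : R := dot u u * dot v v - dot u v ^+ 2.

Lemma gram_dot u v (w := dot u u *: v - dot u v *: u) :
  dot w w = dot u u * gram u v.
Proof. by rewrite /w /gram !dotE (dotC v u); ring. Qed.

Lemma gramC u v : gram u v = gram v u.
Proof. by rewrite /gram (dotC v u) [dot v v * _]mulrC. Qed.

Lemma gramE u v (a b c k : R) :
  gram (a *: u + b *: v) (c *: u + k *: v) = (a * k - b * c) ^+ 2 * gram u v.
Proof. by rewrite /gram !dotE (dotC v u); ring. Qed.

Lemma gram_indep u v (a b : R) : 0 < gram u v -> a *: u + b *: v = 0 ->
  a = 0 /\ b = 0.
Proof.
move=> g0 e.
have h1 : a * dot u u + b * dot u v = 0.
  by rewrite -(dot0l u) -e !dotE (dotC v u).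
have h2 : a * dot u v + b * dot v v = 0 by rewrite -(dot0l v) -e !dotE.
have g1 : gram u v != 0 by rewrite gt_eqF.
split; apply/eqP; rewrite -(mulIr_eq0 _ (mulIf g1)) /gram; apply/eqP.
  transitivity ((a * dot u u + b * dot u v) * dot v v
              - (a * dot u v + b * dot v v) * dot u v); first by ring.
  by rewrite h1 h2 !mul0r subrr.
transitivity ((a * dot u v + b * dot v v) * dot u u
            - (a * dot u u + b * dot u v) * dot u v); first by ring.
by rewrite h1 h2 !mul0r subrr.
Qed.

Lemma gram_coord u v (a b a' b' : R) : 0 < gram u v ->
  a *: u + b *: v = a' *: u + b' *: v -> a = a' /\ b = b'.
Proof.
move=> g0 e; have [] := @gram_indep u v (a - a') (b - b') g0.
  rewrite !scalerBl addrACA -opprD e subrr //.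
by move=> /eqP + /eqP; rewrite !subr_eq0 => /eqP-> /eqP->.
Qed.

(** This trades the rank condition in [collinear] for a strict inequality of a continuous function,
    which persists under small perturbations. *)
Lemma row_free_gram u v : row_free (col_mx u v) = (0 < gram u v).
Proof.
apply/idP/idP => [rf|g0].
  have inj a b : a *: u + b *: v = 0 -> a = 0 /\ b = 0.
    move=> e; have : row_mx a%:M b%:M *m col_mx u v = 0 *m col_mx u v.
      by rewrite mul_row_col !mul_scalar_mx e mul0mx.
    move/(row_free_inj rf)/rowP => z.
    have := z (lshift 1 0); have := z (rshift 1 0).
    by rewrite row_mxEl row_mxEr !mxE eqxx !mulr1n.
  have u0 : u != 0.
    apply/eqP => u0; have [] := inj 1 0; first by rewrite u0 scaler0 scale0r addr0.
    by move/eqP; rewrite oner_eq0.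
  have w0 : dot u u *: v - dot u v *: u != 0.
    apply/eqP; rewrite addrC -scaleNr => /inj[_ /eqP].
    by rewrite dot_eq0 (negPf u0).
  by rewrite -(pmulr_rgt0 _ (_ : 0 < dot u u)) -?gram_dot dot_gt0.
apply: inj_row_free => z; rewrite -[z]hsubmxK mul_row_col.
rewrite [lsubmx z]mx11_scalar [rsubmx z]mx11_scalar !mul_scalar_mx.
by move=> /(gram_indep g0)[-> ->]; rewrite !raddf0 row_mx0.
Qed.

Lemma collinearE A B C : ~~ collinear A B C = (0 < gram (B - A) (C - A)).
Proof. by rewrite negbK row_free_gram. Qed.

Definition quad_ST A B C D (S T : R) : Prop :=
  [/\ 0 < gram (B - A) (D - A), 0 < S, 0 < T
    & C = A + pST S T *: (B - A) + rST S T *: (D - A)].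

Lemma quad_frame A B C D (p r : R) :
  C = A + p *: (B - A) + r *: (D - A) ->
  [/\ C - B = (p - 1) *: (B - A) + r *: (D - A),
      C - D = p *: (B - A) + (r - 1) *: (D - A)
    & C - A = p *: (B - A) + r *: (D - A)].
Proof.
move=> ->; split; apply/rowP => k; rewrite !mxE; ring.
Qed.

(** If the diagonals meet at (1 - s) A + s C = (1 - t) B + t D, then p = (1 - t) / s and r = t / s,
    hence p + r = 1 / s > 1. Conversely s = 1 / (p + r) and t = r / (p + r) give the
    intersection. *)
Lemma convex_quadP A B C D : convex_quad A B C D <-> exists p r : R,
  [/\ 0 < gram (B - A) (D - A), 0 < p, 0 < r, 1 < p + r
    & C = A + p *: (B - A) + r *: (D - A)].
Proof.
split.
  case=> _ _ _; rewrite collinearE => g0 [Q [[s /andP[s0 s1] QE] [t /andP[t0 t1] QE']]].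
  have g : 0 < gram (B - A) (D - A).
    suff -> : gram (B - A) (D - A) = gram (A - D) (B - D) by [].
    rewrite (_ : A - D = 0 *: (B - A) + (-1) *: (D - A)); last first.
      by apply/rowP => k; rewrite !mxE; ring.
    rewrite (_ : B - D = 1 *: (B - A) + (-1) *: (D - A)); last first.
      by apply/rowP => k; rewrite !mxE; ring.
    by rewrite gramE; ring.
  exists ((1 - t) / s), (t / s); split=> //.
  - by rewrite divr_gt0 // subr_gt0.
  - by rewrite divr_gt0.
  - by rewrite -mulrDl subrK ltr_pdivlMr // mul1r.
  - have sI : s != 0 by rewrite gt_eqF.
    apply: (scalerI sI); move: QE; rewrite QE' => /rowP QE; apply/rowP => k.
    move: (QE k); rewrite !mxE => h.
    transitivity ((1 - s) * A 0 k + s * C 0 k - (1 - s) * A 0 k); first by ring.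
    by rewrite -h; field.
case=> p [r [g p0 r0 pr CE]].
have [CB CD CA] := quad_frame CE.
have g1 (a b c k : R) : a * k - b * c != 0 ->
    0 < gram (a *: (B - A) + b *: (D - A)) (c *: (B - A) + k *: (D - A)).
  by move=> n0; rewrite gramE mulr_gt0 // lt_def sqr_ge0 sqrf_eq0 n0.
have DB : D - B = (-1) *: (B - A) + 1 *: (D - A).
  by apply/rowP => k; rewrite !mxE; ring.
have AD : A - D = 0 *: (B - A) + (-1) *: (D - A).
  by apply/rowP => k; rewrite !mxE; ring.
have BA : B - A = 1 *: (B - A) + 0 *: (D - A).
  by apply/rowP => k; rewrite !mxE; ring.
have BD : B - D = 1 *: (B - A) + (-1) *: (D - A).
  by apply/rowP => k; rewrite !mxE; ring.
have AC : A - C = (-p) *: (B - A) + (-r) *: (D - A).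
  by rewrite -opprB CA opprD !scaleNr.
have DC : D - C = (-p) *: (B - A) + (1-r) *: (D - A).
  by rewrite -opprB CD opprD -!scaleNr opprB.
split.
- by rewrite collinearE CA [in gram (B - A)]BA; apply: g1; rewrite gt_eqF //; lra.
- by rewrite collinearE CB DB; apply: g1; rewrite gt_eqF //; lra.
- by rewrite collinearE DC AC; apply: g1; rewrite gt_eqF //; lra.
- by rewrite collinearE AD BD; apply: g1; rewrite gt_eqF //; lra.
have pr0 : 0 < p + r by apply: lt_trans pr.
exists ((1 - (p + r)^-1) *: A + (p + r)^-1 *: C); split.
  by exists (p + r)^-1 => //; rewrite invr_gt0 pr0 invf_lt1.
exists (r / (p + r)).
  by rewrite divr_gt0 // ltr_pdivrMr // mul1r ltrDr.
by apply/rowP => k; rewrite CE !mxE; field; rewrite gt_eqF.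
Qed.

Lemma convex_quad_ST A B C D :
  convex_quad A B C D <-> exists S T, quad_ST A B C D S T.
Proof.
rewrite convex_quadP; split=> [[p [r [g p0 r0 pr CE]]]|[S [T [g S0 T0 CE]]]].
  have := pST_surj p0 r0 pr; set S := Num.sqrt _; set T := Num.sqrt _.
  by move=> [S0 T0 pE rE]; exists S, T; split=> //; rewrite pE rE.
exists (pST S T), (rST S T).
by rewrite pST_gt0 ?rST_gt0 // pST_rST // ltrDl mulr_gt0.
Qed.

Lemma quad_ST_inj A B C D (S T S' T' : R) :
  quad_ST A B C D S T -> quad_ST A B C D S' T' -> S = S' /\ T = T'.
Proof.
move=> [g S0 T0 CE] [_ S0' T0' CE'].
have [_ _ CA] := quad_frame CE; have [_ _ CA'] := quad_frame CE'.
have [pE rE] : pST S T = pST S' T' /\ rST S T = rST S' T'.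
  by apply: (gram_coord g); rewrite -CA -CA'.
exact: ST_inj.
Qed.

Lemma quad_ST_swap A B C D (S T : R) :
  quad_ST A B C D S T -> quad_ST A D C B T S.
Proof.
move=> [g S0 T0 CE]; split=> //; first by rewrite gramC.
rewrite CE addrAC /pST /rST [T * S]mulrC [T + S]addrC //.
Qed.

Lemma quad_ST_flip A B C D (S T : R) :
  quad_ST A B C D S T -> quad_ST D C B A S^-1 T.
Proof.
move=> [g S0 T0 CE]; have [_ CD _] := quad_frame CE.
have AD : A - D = 0 *: (B - A) + (-1) *: (D - A).
  by apply/rowP => k; rewrite !mxE; ring.
split; rewrite ?invr_gt0 //.
  rewrite CD AD gramE mulr_gt0 // lt_def sqr_ge0 sqrf_eq0 andbT.
  by rewrite mulr0 subr0 mulrN1 oppr_eq0 gt_eqF // pST_gt0.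
have ST0 : 0 < S * T by rewrite mulr_gt0.
rewrite CD AD /pST /rST; apply/rowP => k; rewrite !mxE; field.
by rewrite !gt_eqF ?addr_gt0 ?mulr_gt0.
Qed.

Lemma area3E A B C : area3 A B C = Num.sqrt (gram (B - A) (C - A)) / 2.
Proof. by []. Qed.

Lemma sqrt_gramE u v (a b c k : R) :
  Num.sqrt (gram (a *: u + b *: v) (c *: u + k *: v))
  = `|a * k - b * c| * Num.sqrt (gram u v).
Proof. by rewrite gramE sqrtrM ?sqr_ge0 // sqrtr_sqr. Qed.

Lemma area4_frame A B C D e f (a b p r : R) : 0 <= a -> 0 <= b -> 0 <= p -> 0 <= r ->
  B - A = a *: e -> D - A = b *: f -> C - A = p *: e + r *: f ->
  area4 A B C D = (a * r + p * b) * Num.sqrt (gram e f) / 2.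
Proof.
move=> a0 b0 p0 r0 BE DE CE; rewrite /area4 !area3E BE DE CE.
rewrite (_ : a *: e = a *: e + 0 *: f); last by rewrite scale0r addr0.
rewrite (_ : b *: f = 0 *: e + b *: f); last by rewrite scale0r add0r.
rewrite !sqrt_gramE mul0r subr0 mulr0 subr0 !ger0_norm ?mulr_ge0 //.
by field.
Qed.

(** The diagonals meet at Q = A + s (C - A) with s = 1 / (p + r). The triangles AQB and CQD have
    areas proportional to s r and (1 - s) p, with quotient r / (p (p + r - 1)). *)
Lemma opposite_ratioE A B C D (S T : R) : quad_ST A B C D S T ->
  opposite_ratio A B C D = (S ^+ 2)^-1.
Proof.
move=> q; have [g S0 T0 CE] := q.
rewrite (pST_sq S0 T0); move: (pST_gt0 S0 T0) (rST_gt0 S0 T0) (pST_rST S0 T0) CE.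
set p := pST S T; set r := rST S T => p0 r0 pr CE; clearbody p r.
have pr1 : 1 < p + r by rewrite pr ltrDl mulr_gt0.
have pr0 : 0 < p + r by rewrite addr_gt0.
have ne : exists x, (open_segment A C `&` open_segment B D) x.
  by have [] : convex_quad A B C D by apply/convex_quad_ST; exists S, T.
have [[s /andP[s0 s1] QE] [t /andP[t0 t1] QE']] := getPex ne.
rewrite /opposite_ratio; have -> : diag_point A B C D =
   get (open_segment A C `&` open_segment B D) by [].
move: QE QE'; set Q := get _ => QE QE'.
have QA : Q - A = (s * p) *: (B - A) + (s * r) *: (D - A).
  by rewrite QE CE; apply/rowP => k; rewrite !mxE; ring.
have QA' : Q - A = (1 - t) *: (B - A) + t *: (D - A).
  by rewrite QE'; apply/rowP => k; rewrite !mxE; ring.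
have [e1 e2] := gram_coord g (etrans (esym QA) QA').
have sE : s = (p + r)^-1.
  by apply: (mulIf (lt0r_neq0 pr0)); rewrite mulVf ?gt_eqF // mulrDr e1 e2 subrK.
have BA : B - A = 1 *: (B - A) + 0 *: (D - A).
  by apply/rowP => k; rewrite !mxE; ring.
have QC : Q - C = (s * p - p) *: (B - A) + (s * r - r) *: (D - A).
  by rewrite QE CE; apply/rowP => k; rewrite !mxE; ring.
have DC : D - C = (-p) *: (B - A) + (1-r) *: (D - A).
  by rewrite CE; apply/rowP => k; rewrite !mxE; ring.
set G := Num.sqrt (gram (B - A) (D - A)).
have aQ : area3 A Q B = s * r * G / 2.
  rewrite area3E QA {2}BA sqrt_gramE mulr0 mulr1 sub0r normrN gtr0_norm //.
  by rewrite mulr_gt0.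
have cQ : area3 C Q D = (1 - s) * p * G / 2.
  rewrite area3E QC DC sqrt_gramE.
  have -> : (s * p - p) * (1 - r) - (s * r - r) * - p = - ((1 - s) * p) by ring.
  by rewrite normrN gtr0_norm // mulr_gt0 // subr_gt0.
rewrite aQ cQ sE.
have gn : G != 0 by rewrite gt_eqF // sqrtr_gt0.
field; rewrite gn !gt_eqF //; lra.
Qed.

(** The map fixes A and B, so it takes C and D to C' and D' in some order. In the expected order it
    preserves the frame coordinates; the exchanged order has to be refuted since labels are
    ignored. *)
Lemma affine_symmetric_ST A B C D C' D' (S T S' T' : R) :
  quad_ST A B C D S T -> quad_ST A B C' D' S' T' ->
  affine_symmetric A B C D C' D' -> S = S' /\ T = T'.
Proof.
move=> q q' [F [[M [b FE]] im fix_]].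
have [g S0 T0 CE] := q; have [g' S0' T0' CE'] := q'.
have p0 := pST_gt0 S0 T0; have r0 := rST_gt0 S0 T0.
have p0' := pST_gt0 S0' T0'; have r0' := rST_gt0 S0' T0'.
have FA : F A = A by apply: fix_; exists 0; rewrite ?lexx ?ler01 // subr0 scale1r scale0r addr0.
have FB : F B = B by apply: fix_; exists 1; rewrite ?lexx ?ler01 // subrr scale1r scale0r add0r.
have FC : F C = A + pST S T *: (B - A) + rST S T *: (F D - A).
  have -> : F C = F A + pST S T *: (F B - F A) + rST S T *: (F D - F A).
    rewrite !FE CE !mulmxDl -!scalemxAl !mulmxBl.
    by move: (A *m M) (B *m M) (D *m M) => u v w; apply/rowP => k; rewrite !mxE; ring.
  by rewrite FA FB.
have nz (a c : R) : a *: (B - A) + c *: (D' - A) = 0 -> a = 0 /\ c = 0.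
  exact: gram_indep.
have [CB CD CA] := quad_frame CE'.
have nDA : D' <> A.
  move=> e; have [] := nz 0 1; first by rewrite scale0r add0r scale1r e subrr.
  by move=> _ /eqP; rewrite oner_eq0.
have nDB : D' <> B.
  move=> e; have [] := nz 1 (-1); first by rewrite e scale1r scaleN1r subrr.
  by move=> /eqP; rewrite oner_eq0.
have nCA : C' <> A.
  move=> e; have [] := nz (pST S' T') (rST S' T'); first by rewrite -CA e subrr.
  by move=> /eqP; rewrite gt_eqF.
have nCB : C' <> B.
  move=> e; have [] := nz (pST S' T' - 1) (rST S' T'); first by rewrite -CB e subrr.
  by move=> _ /eqP; rewrite gt_eqF.
have nCD : C' <> D'.
  move=> e; have [] := nz (pST S' T') (rST S' T' - 1); first by rewrite -CD e subrr.
  by move=> /eqP; rewrite gt_eqF.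
have cov X : vertices A B C' D' X -> X <> A -> X <> B -> X = F C \/ X = F D.
  by rewrite -im => -[Z [[[->|->]|->]|->] <-]; rewrite ?FA ?FB; auto.
have hD : vertices A B C' D' D' by right.
have hC : vertices A B C' D' C' by left; right.
case: (cov _ hC nCA nCB) => eC; case: (cov _ hD nDA nDB) => eD.
- by case: nCD; rewrite eC eD.
- apply: (@quad_ST_inj A B C' D' S T S' T') => //.
  by split=> //; rewrite eD -FC.
(* Exchanged order: substituting the coordinates of D' - A and C' - A into each other yields a
   relation whose coefficient at B - A is positive, against independence. *)
- have : C' - A = (pST S' T') *: (B - A) + rST S' T' *: (pST S T *: (B - A) + rST S T *: (C' - A)).
    rewrite {1}CA; congr (_ + _ *: _).
    by rewrite eD FC -eC; apply/rowP => k; rewrite !mxE; ring.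
  rewrite CA => h.
  have : (rST S' T' * rST S T * pST S' T' + rST S' T' * pST S T) *: (B - A)
    + (rST S' T' * rST S T * rST S' T' - rST S' T') *: (D' - A) = 0.
    by move/rowP: h => h; apply/rowP => k; move: (h k); rewrite !mxE => hk; lra.
  move=> /nz[e _]; have : 0 < rST S' T' * rST S T * pST S' T' + rST S' T' * pST S T.
    exact: (addr_gt0 (mulr_gt0 (mulr_gt0 r0' r0) p0') (mulr_gt0 r0' p0)).
  by rewrite e ltxx.
- by case: nCD; rewrite eC eD.
Qed.

End PlaneGeometry.

(** * Deformations and edge scales *)

Section ParallelCurves.
Context {R : realType} {d : nat}.

(** Parallelism allows negative factors, but the factor is continuous, never 0 and equal to 1 at
    [t0], hence positive by the intermediate value theorem. Continuity of a deformation enters here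
    only. *)
Lemma parallel_curve_scale (E : R -> 'rV[R]_d) (t0 : R) :
  t0 \in `[0, 1] -> E t0 != 0 -> {within `[0, 1], continuous E} ->
  (forall t, t \in `[0, 1] -> t0 != t -> parallel_vec (E t0) (E t)) ->
  let k t := dot (E t) (E t0) / dot (E t0) (E t0) in
  k t0 = 1 /\ (forall t, t \in `[0, 1] -> E t = k t *: E t0 /\ 0 < k t).
Proof.
move=> t0I e0 Ec Ep k; set e := E t0 in e0 k *.
have ee : dot e e != 0 by rewrite dot_eq0.
have k0 : k t0 = 1 by rewrite /k divff.
split=> //.
have kE t : t \in `[0, 1] -> E t = k t *: e /\ k t != 0.
  move=> tI; have [<-|t0t] := eqVneq t0 t; first by rewrite k0 scale1r oner_neq0.
  have [c c0 Et] := Ep t tI t0t.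
  by rewrite /k Et dotZl mulfK.
have kc : {within `[0, 1], continuous k}.
  apply/subspace_continuousP => t tI; apply: cvgM; last exact: cvg_cst.
  have Et := (subspace_continuousP _ _).1 Ec t tI.
  suff : forall (r : seq 'I_d), \sum_(i <- r) E x 0 i * e 0 i
      @[x --> within `[0, 1] (nbhs t)] --> \sum_(i <- r) E t 0 i * e 0 i by apply.
  elim=> [|i r IH].
    by rewrite big_nil; under eq_fun do rewrite big_nil; exact: cvg_cst.
  rewrite big_cons; under eq_fun do rewrite big_cons.
  apply: cvgD => //; apply: cvgM; last exact: cvg_cst.
  exact: (continuous_cvg _ (@coord_continuous _ _ _ 0 i (E t)) Et).
move=> t tI; have [Et kt0] := kE t tI; split=> //.
rewrite lt_def kt0 leNgt; apply/negP => kn.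
have sub a b : a \in `[0, 1] -> b \in `[0, 1] ->
    {within `[a, b], continuous k}.
  rewrite !in_itv /= => /andP[a0 a1] /andP[b0 b1].
  apply: continuous_subspaceW kc => x /=; rewrite !in_itv /= => /andP[ax xb].
  by rewrite (le_trans a0 ax) (le_trans xb b1).
have noz a b : a \in `[0, 1] -> b \in `[0, 1] -> a <= b ->
    Num.min (k a) (k b) <= 0 <= Num.max (k a) (k b) -> False.
  move=> aI bI ab /(IVT ab (sub a b aI bI))[c cI /eqP kc0].
  have cI' : c \in `[0, 1].
    move: cI aI bI; rewrite !in_itv /= => /andP[ac cb] /andP[a0 _] /andP[_ b1].
    by rewrite (le_trans a0 ac) (le_trans cb b1).
  by have [_] := kE c cI'; rewrite kc0.
have [tt|tt] := leP t t0.
  by apply: (noz t t0) => //; rewrite k0 ge_min le_max ler01 (ltW kn) !orbT.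
by apply: (noz t0 t) => //; [exact: ltW | rewrite k0 ge_min le_max ler01 (ltW kn) !orbT].
Qed.

End ParallelCurves.

Section ScalesOfNets.
Context {R : realType} {d : nat}.
Local Notation pt := 'rV[R]_d.
Variables m n : nat.
Implicit Types (P F : nat -> nat -> pt) (S T : nat -> nat -> R).

Definition net_ST P S T : Prop := forall i j, net_face m n i j ->
  quad_ST (P i j) (P i.+1 j) (P i.+1 j.+1) (P i j.+1) (S i j) (T i j).

Lemma net_ST_is_net P S T : net_ST P S T -> is_net m n P.
Proof.
by move=> q i j ij; apply/convex_quad_ST; exists (S i j), (T i j); apply: q.
Qed.

Lemma quad_edges (A B C D : pt) (s t : R) : quad_ST A B C D s t ->
  [/\ B - A != 0, D - A != 0, C - B != 0 & C - D != 0].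
Proof.
move=> q; have [g s0 t0 CE] := q; have [CB CD _] := quad_frame CE.
have nz (a b : R) : b != 0 -> a *: (B - A) + b *: (D - A) != 0.
  by apply: contraNneq => /(gram_indep g)[_ ->].
have nz' (a b : R) : a != 0 -> a *: (B - A) + b *: (D - A) != 0.
  by apply: contraNneq => /(gram_indep g)[->].
split.
- by have := nz' 1 0 (oner_neq0 _); rewrite scale1r scale0r addr0.
- by have := nz 0 1 (oner_neq0 _); rewrite scale1r scale0r add0r.
- by rewrite CB nz // gt_eqF // rST_gt0.
- by rewrite CD nz' // gt_eqF // pST_gt0.
Qed.

Lemma net_edges P S T : (0 < m)%N -> (0 < n)%N -> net_ST P S T ->
  (forall i j, (i < m)%N -> (j <= n)%N -> P i.+1 j - P i j != 0) /\
  (forall i j, (i <= m)%N -> (j < n)%N -> P i j.+1 - P i j != 0).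
Proof.
move=> m0 n0 q; split=> i j.
- move=> im; case: j => [_|j jn].
    by have /q/quad_edges[] : net_face m n i 0 by rewrite /net_face im.
  by have /q/quad_edges[] : net_face m n i j by rewrite /net_face im.
- case: i => [_ jn|i im jn].
    by have /q/quad_edges[] : net_face m n 0 j by rewrite /net_face m0.
  by have /q/quad_edges[] : net_face m n i j by rewrite /net_face im.
Qed.

(** Closure is automatic, as both paths from A' end at C'; thus the area is the only condition left
    to compare. *)
Lemma edge_parallel_face_scale (A B C D A' B' C' D' : pt) (S T a b c k : R) :
  quad_ST A B C D S T -> 0 < a -> 0 < b -> 0 < c -> 0 < k ->
  B' - A' = a *: (B - A) -> C' - B' = b *: (C - B) ->
  C' - D' = c *: (C - D) -> D' - A' = k *: (D - A) ->
  area4 A' B' C' D' = area4 A B C D <-> face_scale S T a b c k.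
Proof.
move=> q a0 b0 c0 k0 BE CE DE AE; have [g S0 T0 qE] := q.
have [CB CD CA] := quad_frame qE.
have p0 := pST_gt0 S0 T0; have r0 := rST_gt0 S0 T0.
set p := pST S T in qE CB CD CA p0 *; set r := rST S T in qE CB CD CA r0 *.
have CA1 : C' - A' = (a + b * (p - 1)) *: (B - A) + (b * r) *: (D - A).
  rewrite -[C'](subrK B') -addrA BE CE CB scalerDr !scalerA addrAC -scalerDl.
  by rewrite [b * _ + a]addrC.
have CA2 : C' - A' = (c * p) *: (B - A) + (k + c * (r - 1)) *: (D - A).
  rewrite -[C'](subrK D') -addrA DE AE CD scalerDr !scalerA -addrA -scalerDl.
  by rewrite [c * (r - 1) + _]addrC.
have [e1 e2] := gram_coord g (etrans (esym CA1) CA2).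
have CA3 : C' - A' = (c * p) *: (B - A) + (b * r) *: (D - A).
  by rewrite CA1 e1.
rewrite (area4_frame _ _ _ _ BE AE CA3) ?ltW // 1?mulr_gt0 //.
have e1r (u : pt) : u = 1 *: u by rewrite scale1r.
rewrite (area4_frame _ _ _ _ (e1r (B - A)) (e1r (D - A)) CA) ?ltW //.
have G0 : Num.sqrt (gram (B - A) (D - A)) / 2 != 0.
  by rewrite gt_eqF // divr_gt0 // sqrtr_gt0.
have M (x : R) : x * Num.sqrt (gram (B - A) (D - A)) / 2
    = x * (Num.sqrt (gram (B - A) (D - A)) / 2) by rewrite mulrA.
rewrite !M; split.
  move/(mulIf G0) => e; apply: face_scaleP => //.
  by move: e; rewrite -/p -/r; lra.
move/(face_scale_area S0 T0); rewrite -/p -/r => e; congr (_ * _); lra.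
Qed.

Lemma deformable_scale_family P S T : (0 < m)%N -> (0 < n)%N ->
  net_ST P S T -> deformable m n P -> exists h v, scale_family m n S T h v.
Proof.
move=> m0 n0 q [F [Fnet Fc Fp [t0 t0I FP]]].
have [eh ev] := net_edges m0 n0 q.
have idxh i j : (i < m)%N -> (j <= n)%N -> net_idx m n i j /\ net_idx m n i.+1 j.
  by move=> im jn; rewrite /net_idx im (ltnW im) jn.
have idxv i j : (i <= m)%N -> (j < n)%N -> net_idx m n i j /\ net_idx m n i j.+1.
  by move=> im jn; rewrite /net_idx im jn (ltnW jn).
pose hE t i j := F t i.+1 j - F t i j; pose vE t i j := F t i j.+1 - F t i j.
pose h t i j := dot (hE t i j) (hE t0 i j) / dot (hE t0 i j) (hE t0 i j).
pose v t i j := dot (vE t i j) (vE t0 i j) / dot (vE t0 i j) (vE t0 i j).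
have subc (G1 G2 : R -> pt) : {within `[0, 1], continuous G1} ->
    {within `[0, 1], continuous G2} -> {within `[0, 1], continuous (fun t => G1 t - G2 t)}.
  by move=> c1 c2 t; apply: cvgB; [exact: c1 | exact: c2].
have h0 i j : (i < m)%N -> (j <= n)%N -> h t0 i j = 1 /\ forall t, t \in `[0, 1] ->
    hE t i j = h t i j *: (P i.+1 j - P i j) /\ 0 < h t i j.
  move=> im jn; have [i1 i2] := idxh i j im jn.
  have hP : hE t0 i j = P i.+1 j - P i j by rewrite /hE !FP.
  rewrite -hP; apply: (@parallel_curve_scale _ _ (fun t => hE t i j)) => //.
  - by rewrite hP eh.
  - by apply: subc; apply: Fc.
  - by move=> t tI tt; have [[+ _] _ _] := Fp _ _ t0I tI tt; apply.
have v0 i j : (i <= m)%N -> (j < n)%N -> v t0 i j = 1 /\ forall t, t \in `[0, 1] ->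
    vE t i j = v t i j *: (P i j.+1 - P i j) /\ 0 < v t i j.
  move=> im jn; have [i1 i2] := idxv i j im jn.
  have vP : vE t0 i j = P i j.+1 - P i j by rewrite /vE !FP.
  rewrite -vP; apply: (@parallel_curve_scale _ _ (fun t => vE t i j)) => //.
  - by rewrite vP ev.
  - by apply: subc; apply: Fc.
  - by move=> t tI tt; have [[_ +] _ _] := Fp _ _ t0I tI tt; apply.
exists h, v; split.
- by move=> t i j tI im jn; have [_ /(_ _ tI)[]] := h0 i j im jn.
- by move=> t i j tI im jn; have [_ /(_ _ tI)[]] := v0 i j im jn.
- move=> t i j tI im jn; have fij : net_face m n i j by rewrite /net_face im.
  have [_ /(_ _ tI)[h1 h1p]] := h0 i j im (ltnW jn).
  have [_ /(_ _ tI)[h2 h2p]] := h0 i j.+1 im jn.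
  have [_ /(_ _ tI)[v1 v1p]] := v0 i j (ltnW im) jn.
  have [_ /(_ _ tI)[v2 v2p]] := v0 i.+1 j im jn.
  apply/(edge_parallel_face_scale (q i j fij) h1p v2p h2p v1p h1 v2 h2 v1).
  have -> : area4 (P i j) (P i.+1 j) (P i.+1 j.+1) (P i j.+1)
      = on_face area4 (F t0) i j.
    by rewrite /on_face !FP // /net_idx ?im ?jn ?(ltnW im) ?(ltnW jn).
  have [<-//|tt] := eqVneq t t0.
  by have [_ _ e] := Fp _ _ tI t0I tt; exact: (e i j fij).
- exists t0 => //; split=> i j im jn; first by have [] := h0 i j im jn.
  by have [] := v0 i j im jn.
- move=> s t sI tI hst vst; apply/eqP/negPn/negP => st.
  have [_ + _] := Fp _ _ sI tI st; apply.
  (* Nets with equal scales are translates of each other, against non-congruence. *)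
  exists (fun x => x + (F t 0 0 - F s 0 0)).
    by move=> x y; rewrite /Defs.edist opprD addrACA subrr addr0.
  have row i : (i <= m)%N -> F s i 0 + (F t 0 0 - F s 0 0) = F t i 0.
    elim: i => [_|i IH im]; first by rewrite addrC subrK.
    have [_ H] := h0 i 0 im (leq0n _).
    have [h1 _] := H s sI; have [h2 _] := H t tI.
    have hh : hE s i 0 = hE t i 0 by rewrite h1 h2 hst.
    rewrite -[F t i.+1 0](subrK (F t i 0)) -/(hE t i 0) -hh -(IH (ltnW im)) /hE.
    by rewrite [RHS]addrA subrK.
  move=> i j /andP[im]; elim: j => [_|j IH jn]; first exact: row.
  have [_ H] := v0 i j im jn.
  have [h1 _] := H s sI; have [h2 _] := H t tI.
  have hh : vE s i j = vE t i j by rewrite h1 h2 vst.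
  rewrite -[F t i j.+1](subrK (F t i j)) -/(vE t i j) -hh -(IH (ltnW jn)) /vE.
  by rewrite [RHS]addrA subrK.
Qed.

Lemma scale_family_deformable P S T h v : (0 < m)%N -> (0 < n)%N ->
  net_ST P S T -> scale_family m n S T h v ->
  (forall i j, (i < m)%N -> (j <= n)%N ->
     {within `[0, 1], continuous (fun t => h t i j)}) ->
  (forall i j, (i <= m)%N -> (j < n)%N ->
     {within `[0, 1], continuous (fun t => v t i j)}) ->
  deformable m n P.
Proof.
move=> m0 n0 q hv hc vc; have [hp vp hvf [t0 t0I [h1 v1]] inj] := hv.
have [eh ev] := net_edges m0 n0 q.
(* Each vertex is reached along the bottom row and then up its column. Vertical edges are scaled by
   construction; horizontal edges above the bottom row are so by closure of the faces, by induction
   on the height. *)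
pose F t i j := P 0%N 0%N + \sum_(0 <= k < i) h t k 0%N *: (P k.+1 0%N - P k 0%N)
  + \sum_(0 <= l < j) v t i l *: (P i l.+1 - P i l).
have vE t i j : F t i j.+1 - F t i j = v t i j *: (P i j.+1 - P i j).
  by rewrite /F big_nat_recr //= addrA [X in X - _]addrC addrK.
have hE t i j : t \in `[0, 1] -> (i < m)%N -> (j <= n)%N ->
    F t i.+1 j - F t i j = h t i j *: (P i.+1 j - P i j).
  move=> tI im; elim: j => [_|j IH jn].
    by rewrite /F !(big_geq (leqnn 0)) !addr0 big_nat_recr //= addrA [X in X - _]addrC addrK.
  have fij : net_face m n i j by rewrite /net_face im.
  have [g S0 T0 qE] := q i j fij; have [CB CD _] := quad_frame qE.
  have [e1 e2] := face_scale_closure S0 T0 (hvf t i j tI im jn).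
  have -> : F t i.+1 j.+1 - F t i j.+1 =
      (F t i.+1 j.+1 - F t i.+1 j) + (F t i.+1 j - F t i j) - (F t i j.+1 - F t i j).
    by apply/rowP => k; rewrite !mxE; ring.
  rewrite !vE (IH (ltnW jn)) CB CD.
  transitivity ((h t i j + v t i.+1 j * (pST (S i j) (T i j) - 1)) *: (P i.+1 j - P i j)
     + (v t i.+1 j * rST (S i j) (T i j) - v t i j) *: (P i j.+1 - P i j)).
    by apply/rowP => k; rewrite !mxE; ring.
  by rewrite e1 e2; apply/rowP => k; rewrite !mxE; ring.
have pos t i j : t \in `[0, 1] -> (i < m)%N -> (j < n)%N ->
  [/\ 0 < h t i j, 0 < v t i.+1 j, 0 < h t i j.+1 & 0 < v t i j].
  exact: (scale_pos hv).
exists F; split.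
- move=> t tI i j /andP[im jn]; have fij : net_face m n i j by rewrite /net_face im.
  have [g S0 T0 qE] := q i j fij; have [CB CD _] := quad_frame qE.
  have [a0 b0 c0 d0] := pos t i j tI im jn.
  have [e1 e2] := face_scale_closure S0 T0 (hvf t i j tI im jn).
  have p0 := pST_gt0 S0 T0; have r0 := rST_gt0 S0 T0.
  have pr : 1 < pST (S i j) (T i j) + rST (S i j) (T i j).
    by rewrite pST_rST // ltrDl mulr_gt0.
  move: e1 e2 qE CB CD p0 r0 pr; move: (pST _ _) (rST _ _) => p r e1 e2 qE CB CD p0 r0 pr.
  (* In the scaled frame the coordinates become p' = c p / a and r' = b r / d, and closure gives p'
     + r' - 1 = b c (p + r - 1) / (a d) > 0. *)
  apply/convex_quadP; exists (h t i j.+1 * p / h t i j), (v t i.+1 j * r / v t i j).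
  split; try by rewrite divr_gt0 ?mulr_gt0.
  + have -> : F t i.+1 j - F t i j
        = h t i j *: (P i.+1 j - P i j) + 0 *: (P i j.+1 - P i j).
      by rewrite scale0r addr0 hE // ltnW.
    have -> : F t i j.+1 - F t i j
        = 0 *: (P i.+1 j - P i j) + v t i j *: (P i j.+1 - P i j).
      by rewrite scale0r add0r vE.
    by rewrite gramE mulr_gt0 // mulr0 subr0 exprn_gt0 // mulr_gt0.
  + rewrite -subr_gt0 (_ : _ - 1 = v t i.+1 j * h t i j.+1 * (p + r - 1) /
        (h t i j * v t i j)).
      by rewrite divr_gt0 ?mulr_gt0 // subr_gt0.
    have hn : h t i j != 0 by rewrite gt_eqF.
    have vn : v t i j != 0 by rewrite gt_eqF.
    apply: (mulIf (mulf_neq0 hn vn)); rewrite divfK ?mulf_neq0 //.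
    transitivity (h t i j.+1 * p * v t i j + v t i.+1 j * r * h t i j - h t i j * v t i j).
      by field; rewrite hn vn.
    have -> : h t i j = h t i j.+1 * p - v t i.+1 j * (p - 1) by rewrite -e1 addrK.
    have -> : v t i j = v t i.+1 j * r - h t i j.+1 * (r - 1) by rewrite e2 addrK.
    by ring.
  + have hn : h t i j != 0 by rewrite gt_eqF.
    have vn : v t i j != 0 by rewrite gt_eqF.
    have fv := vE t i.+1 j; have fh := hE t i j tI im (ltnW jn); have fv' := vE t i j.
    rewrite fh fv' !scalerA !divfK // -e1 -[F t i.+1 j.+1](subrK (F t i.+1 j)) fv CB.
    rewrite -[F t i.+1 j](subrK (F t i j)) fh.
    by apply/rowP => k; rewrite !mxE; ring.
- move=> i j /andP[im jn]; apply/subspace_continuousP => t tI.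
  apply: cvgD; first apply: cvgD; first exact: cvg_cst.
    elim: i im => [|i IH] im.
      by under eq_fun do rewrite big_geq //; rewrite big_geq //; exact: cvg_cst.
    under eq_fun do rewrite big_nat_recr //=.
    rewrite big_nat_recr //=; apply: cvgD; first exact: (IH (ltnW im)).
    apply: cvgZ; last exact: cvg_cst.
    exact: (subspace_continuousP _ _).1 (hc i 0%N im (leq0n _)) t tI.
  elim: j jn => [|j IH] jn.
    by under eq_fun do rewrite big_geq //; rewrite big_geq //; exact: cvg_cst.
  under eq_fun do rewrite big_nat_recr //=.
  rewrite big_nat_recr //=; apply: cvgD; first exact: (IH (ltnW jn)).
  apply: cvgZ; last exact: cvg_cst.
  exact: (subspace_continuousP _ _).1 (vc i j im jn) t tI.
- move=> s t sI tI st; split.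
  + split=> i j im jn.
      rewrite !hE //; exists (h t i j / h s i j).
        by rewrite gt_eqF // divr_gt0 // hp.
      by rewrite scalerA divfK // gt_eqF // hp.
    rewrite !vE; exists (v t i j / v s i j).
      by rewrite gt_eqF // divr_gt0 // vp.
    by rewrite scalerA divfK // gt_eqF // vp.
  + move=> [f fI fF]; case/eqP: st.
    (* An isometry preserves edge lengths, and these determine the positive scales. *)
    have len (a b : R) (e : pt) : 0 < a -> 0 < b -> e != 0 ->
        dot (a *: e) (a *: e) = dot (b *: e) (b *: e) -> a = b.
      move=> a0 b0 e0; rewrite !dotE !mulrA.
      have /mulIf ee : dot e e != 0 by rewrite dot_eq0.
      by move=> /ee /eqP; rewrite -!expr2 eqrXn2 ?ltW // => /eqP.
    have iso i j k l : net_idx m n i j -> net_idx m n k l ->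
        dot (F s k l - F s i j) (F s k l - F s i j) = dot (F t k l - F t i j) (F t k l - F t i j).
      move=> ij kl; have := fI (F s i j) (F s k l); rewrite !fF // /Defs.edist => /eqP.
      by rewrite eqr_sqrt ?dot_ge0 // => /eqP.
    apply: inj => // i j im jn.
      apply: (len _ _ (P i.+1 j - P i j)); rewrite ?hp ?eh // -!hE //.
      by apply: iso; rewrite /net_idx ?im ?jn ?(ltnW im).
    apply: (len _ _ (P i j.+1 - P i j)); rewrite ?vp ?ev // -!vE //.
    by apply: iso; rewrite /net_idx ?im ?jn ?(ltnW jn).
  + move=> i j /andP[im jn]; have fij : net_face m n i j by rewrite /net_face im.
    have ar u : u \in `[0, 1] -> on_face area4 (F u) i j = on_face area4 P i j.
      move=> uI; have [a0 b0 c0 d0] := pos u i j uI im jn.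
      apply/(edge_parallel_face_scale (q i j fij) a0 b0 c0 d0 (hE _ _ _ uI im (ltnW jn))
        (vE _ _ _) (hE _ _ _ uI im jn) (vE _ _ _)).
      exact: hvf.
    by rewrite !ar.
- exists t0 => // i j /andP[im jn].
  have row k : (k <= m)%N -> F t0 k 0%N = P k 0%N.
    elim: k => [_|k IH km]; first by rewrite /F !(big_geq (leqnn 0)) !addr0.
    apply/eqP; rewrite -subr_eq0 -(subrK (F t0 k 0%N) (F t0 k.+1 0%N)) hE // h1 //.
    by rewrite scale1r (IH (ltnW km)) subrK subrr.
  elim: j jn => [|j IH] jn; first exact: row.
  by rewrite -(subrK (F t0 i j) (F t0 i j.+1)) vE v1 // scale1r (IH (ltnW jn)) subrK.
Qed.

End ScalesOfNets.

(** * Face parameters as continuous functions of the vertices *)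

Section FaceInvariants.
Context {R : realType} {d : nat}.
Local Notation pt := 'rV[R]_d.
Implicit Types A B C D e f w : pt.

(** Cramer's rule for the coordinates of [w] in the frame (e, f), with the Gram matrix as
    coefficients: a closed formula, hence continuous where [gram e f] is not 0. *)
Definition frame_p e f w : R :=
  (dot w e * dot f f - dot w f * dot e f) / gram e f.
Definition frame_r e f w : R :=
  (dot w f * dot e e - dot w e * dot e f) / gram e f.

Definition face_S A B C D : R :=
  let p := frame_p (B - A) (D - A) (C - A) in
  let r := frame_r (B - A) (D - A) (C - A) in Num.sqrt (p * (p + r - 1) / r).
Definition face_T A B C D : R :=
  let p := frame_p (B - A) (D - A) (C - A) in
  let r := frame_r (B - A) (D - A) (C - A) in Num.sqrt (r * (p + r - 1) / p).

Lemma frameE e f (p r : R) : 0 < gram e f ->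
  frame_p e f (p *: e + r *: f) = p /\ frame_r e f (p *: e + r *: f) = r.
Proof.
move=> g; rewrite /frame_p /frame_r !dotE (dotC f e).
by split; apply: (mulIf (lt0r_neq0 g)); rewrite divfK ?gt_eqF // /gram; ring.
Qed.

Lemma face_STE A B C D (S T : R) : quad_ST A B C D S T ->
  face_S A B C D = S /\ face_T A B C D = T.
Proof.
move=> [g S0 T0 CE]; have [_ _ CA] := quad_frame CE.
rewrite /face_S /face_T CA; have [-> ->] := frameE (pST S T) (rST S T) g.
by rewrite -(pST_sq S0 T0) -(rST_sq S0 T0) !sqrtr_sqr !gtr0_norm.
Qed.

Lemma convex_face_ST A B C D : convex_quad A B C D ->
  quad_ST A B C D (face_S A B C D) (face_T A B C D).
Proof. by move=> /convex_quad_ST[S [T q]]; have [-> ->] := face_STE q. Qed.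

Section Continuity.
Context {X : Type} {F : set_system X} {FF : Filter F}.

Lemma cvg_dot (f g : X -> pt) (a b : pt) : f @ F --> a -> g @ F --> b ->
  dot (f x) (g x) @[x --> F] --> dot a b.
Proof.
move=> fa gb.
suff : forall r : seq 'I_d, \sum_(i <- r) f x 0 i * g x 0 i @[x --> F]
   --> \sum_(i <- r) a 0 i * b 0 i by apply.
elim=> [|i r IH].
  by rewrite big_nil; under eq_fun do rewrite big_nil; exact: cvg_cst.
rewrite big_cons; under eq_fun do rewrite big_cons.
apply: cvgD => //; apply: cvgM.
  exact: (continuous_cvg _ (@coord_continuous _ _ _ 0 i a) fa).
exact: (continuous_cvg _ (@coord_continuous _ _ _ 0 i b) gb).
Qed.

Lemma cvg_gram (f g : X -> pt) (a b : pt) : f @ F --> a -> g @ F --> b ->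
  gram (f x) (g x) @[x --> F] --> gram a b.
Proof.
move=> fa gb; apply: cvgB; first by apply: cvgM; exact: cvg_dot.
by rewrite expr2; apply: cvgM; exact: cvg_dot.
Qed.

Lemma cvg_frame (f g h : X -> pt) (a b c : pt) : 0 < gram a b ->
  f @ F --> a -> g @ F --> b -> h @ F --> c ->
  frame_p (f x) (g x) (h x) @[x --> F] --> frame_p a b c /\
  frame_r (f x) (g x) (h x) @[x --> F] --> frame_r a b c.
Proof.
move=> g0 fa gb hc.
have V : (gram (f x) (g x))^-1 @[x --> F] --> (gram a b)^-1.
  by apply: cvgV; [rewrite gt_eqF | exact: cvg_gram].
by split; apply: cvgM => //; apply: cvgB; apply: cvgM; exact: cvg_dot.
Qed.

Lemma cvg_face_ST (A B C D : X -> pt) (A0 B0 C0 D0 : pt) (S T : R) :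
  quad_ST A0 B0 C0 D0 S T ->
  A @ F --> A0 -> B @ F --> B0 -> C @ F --> C0 -> D @ F --> D0 ->
  face_S (A x) (B x) (C x) (D x) @[x --> F] --> face_S A0 B0 C0 D0 /\
  face_T (A x) (B x) (C x) (D x) @[x --> F] --> face_T A0 B0 C0 D0.
Proof.
move=> [g S0 T0 CE] cA cB cC cD.
have [_ _ CA] := quad_frame CE.
have [pE rE] := frameE (pST S T) (rST S T) g; rewrite -CA in pE rE.
have cBA : B x - A x @[x --> F] --> B0 - A0 by exact: cvgB.
have cDA : D x - A x @[x --> F] --> D0 - A0 by exact: cvgB.
have cCA : C x - A x @[x --> F] --> C0 - A0 by exact: cvgB.
have [cp cr] := cvg_frame g cBA cDA cCA.
have pn : frame_p (B0 - A0) (D0 - A0) (C0 - A0) != 0.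
  by rewrite pE gt_eqF // pST_gt0.
have rn : frame_r (B0 - A0) (D0 - A0) (C0 - A0) != 0.
  by rewrite rE gt_eqF // rST_gt0.
rewrite /face_S /face_T.
set p0 := frame_p _ _ _ in cp pn *; set r0 := frame_r _ _ _ in cr rn *.
set p := fun x => frame_p (B x - A x) (D x - A x) (C x - A x) in cp *.
set r := fun x => frame_r (B x - A x) (D x - A x) (C x - A x) in cr *.
have c1 : p x + r x - 1 @[x --> F] --> p0 + r0 - 1.
  by apply: cvgB; [exact: cvgD | exact: cvg_cst].
have cS : p x * (p x + r x - 1) / r x @[x --> F] --> p0 * (p0 + r0 - 1) / r0.
  by apply: cvgM; [exact: cvgM | exact: cvgV].
have cT : r x * (p x + r x - 1) / p x @[x --> F] --> r0 * (p0 + r0 - 1) / p0.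
  by apply: cvgM; [exact: cvgM | exact: cvgV].
split; first exact: (cvg_comp _ _ cS (@sqrt_continuous _ _)).
exact: (cvg_comp _ _ cT (@sqrt_continuous _ _)).
Qed.

End Continuity.
End FaceInvariants.

(** * Completion of an L-shaped net *)

Section Alternating.
Context {R : realType}.
Implicit Types S T : nat -> nat -> R.

(* Case (ii) of the theorem makes both S and T alternate, case (i) only one of
   them, the other one being constant in the same direction. *)
Definition alternating S T : Prop :=
  (forall i j, S i j.+1 = (S i j)^-1) /\
    ((forall i j, T i j.+1 = T i j) \/ (forall i j, T i.+1 j = (T i j)^-1)) \/
  (forall i j, T i.+1 j = (T i j)^-1) /\
    ((forall i j, S i.+1 j = S i j) \/ (forall i j, S i j.+1 = (S i j)^-1)).

Lemma alternating_family_exists m n S T : (0 < m)%N -> (0 < n)%N ->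
  (forall i j, 0 < S i j) -> (forall i j, 0 < T i j) -> alternating S T ->
  exists h v : R -> nat -> nat -> R,
  [/\ scale_family m n S T h v,
      forall i j, (i < m)%N -> (j <= n)%N ->
        {within `[0, 1], continuous (fun t => h t i j)}
    & forall i j, (i <= m)%N -> (j < n)%N ->
        {within `[0, 1], continuous (fun t => v t i j)}].
Proof.
move=> m0 n0 S0 T0 [[SV mode]|[TV mode]]; first exact: scale_family_exists.
have [||h [v [hv hc vc]]] := @scale_family_exists R n m
  (fun i j => T j i) (fun i j => S j i) n0 m0 (fun i j => T0 j i) (fun i j => S0 j i).
- by move=> i j; exact: TV.
- by case: mode => mode; [left|right] => i j; exact: mode.
exists (fun t i j => v t j i), (fun t i j => h t j i); split.
- exact: scale_familyT hv.
- by move=> i j im jn; exact: vc.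
- by move=> i j im jn; exact: hc.
Qed.

Lemma L_faceC m n i j : L_face m n i j = L_face n m j i.
Proof. by rewrite /L_face orbC. Qed.

Lemma alternating_family_unique m n S T S' T' h v :
  (forall i j, 0 < S i j) -> (forall i j, 0 < T i j) ->
  (forall i j, (i < m)%N -> (j < n)%N -> 0 < S' i j) ->
  (forall i j, (i < m)%N -> (j < n)%N -> 0 < T' i j) ->
  alternating S T -> scale_family m n S' T' h v ->
  (forall i j, L_face m n i j -> S' i j = S i j /\ T' i j = T i j) ->
  forall i j, (i < m)%N -> (j < n)%N -> S' i j = S i j /\ T' i j = T i j.
Proof.
move=> S0 T0 S0' T0' [[SV mode]|[TV mode]] hv LE.
  exact: (scale_family_unique S0 T0 S0' T0' SV mode hv LE).
move=> i j im jn; suff [] : T' i j = T i j /\ S' i j = S i j by [].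
apply: (@scale_family_unique R n m (fun i j => T j i) (fun i j => S j i)
  (fun i j => T' j i) (fun i j => S' j i)
  (fun t i j => v t j i) (fun t i j => h t j i)) => //.
- by move=> k l kn lm; exact: T0'.
- by move=> k l kn lm; exact: S0'.
- by case: mode => mode; [left|right] => k l; exact: mode.
- exact: scale_familyT hv.
- by move=> k l; rewrite L_faceC => /LE[].
Qed.

End Alternating.

Section Completion.
Context {R : realType} {d : nat}.
Local Notation pt := 'rV[R]_d.
Variables m n : nat.
Implicit Types (L P : nat -> nat -> pt) (S T : nat -> nat -> R).

Definition fourth_vertex (A B D : pt) (s t : R) : pt :=
  A + pST s t *: (B - A) + rST s t *: (D - A).

(** Only the vertices with index [i = 0] or [j = 0] are taken from [L]; those next to them are
    rebuilt and shown to agree with [L] afterwards. *)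
Fixpoint completion S T L (i : nat) : nat -> pt :=
  if i is i'.+1 then
    fix column j := if j is j'.+1 then
        fourth_vertex (completion S T L i' j') (column j') (completion S T L i' j)
          (S i' j') (T i' j')
      else L i 0%N
  else L 0%N.

Lemma completion0j S T L j : completion S T L 0 j = L 0%N j.
Proof. by []. Qed.

Lemma completioni0 S T L i : completion S T L i 0 = L i 0%N.
Proof. by case: i. Qed.

Lemma completionSS S T L i j : completion S T L i.+1 j.+1 =
  fourth_vertex (completion S T L i j) (completion S T L i.+1 j)
    (completion S T L i j.+1) (S i j) (T i j).
Proof. by []. Qed.

Lemma completion_unique S T L P :
  (forall i, (i <= m)%N -> P i 0%N = L i 0%N) ->
  (forall j, (j <= n)%N -> P 0%N j = L 0%N j) ->
  (forall i j, (i < m)%N -> (j < n)%N -> P i.+1 j.+1 =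
     fourth_vertex (P i j) (P i.+1 j) (P i j.+1) (S i j) (T i j)) ->
  net_eq m n P (completion S T L).
Proof.
move=> Pi Pj PSS i j /andP[]; elim: i j => [|i IHi] j; first by move=> _; exact: Pj.
move=> im; elim: j => [_|j IHj jn]; first exact: Pi.
rewrite completionSS PSS // IHj ?(ltnW jn) // !IHi ?(ltnW im) ?(ltnW jn) //.
Qed.

(** The default 1 keeps the parameters positive at all indices, as the existence of scale families
    demands. *)
Definition L_face_S L i j : R := if L_face m n i j then on_face face_S L i j else 1.
Definition L_face_T L i j : R := if L_face m n i j then on_face face_T L i j else 1.

Definition alt (k : nat) (x : R) : R := if odd k then x^-1 else x.

Lemma altS k x : alt k.+1 x = (alt k x)^-1.
Proof. by rewrite /alt /=; case: (odd k) => //=; rewrite invrK. Qed.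

Lemma alt_gt0 k x : 0 < x -> 0 < alt k x.
Proof. by rewrite /alt; case: (odd k); rewrite ?invr_gt0. Qed.

(** Each flag selects alternation ([true]) or constancy ([false]), and the arm of the L-shape from
    which values are propagated. Affine symmetry corresponds to the modes (true, false) and (false,
    true), equal opposite ratios to (true, true). *)
Definition ext_S (b : bool) L i j : R :=
  if b then alt j (L_face_S L i 0) else L_face_S L 0 j.
Definition ext_T (b : bool) L i j : R :=
  if b then alt i (L_face_T L 0 j) else L_face_T L i 0.

Definition extends (b : bool * bool) L : Prop :=
  forall i j, L_face m n i j ->
    ext_S b.1 L i j = L_face_S L i j /\ ext_T b.2 L i j = L_face_T L i j.

Lemma ext_alternating (b : bool * bool) L : b.1 || b.2 -> alternating (ext_S b.1 L) (ext_T b.2 L).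
Proof.
case: b => [[] []] //= _; [left|left|right]; split.
- by move=> i j; rewrite /ext_S altS.
- by right=> i j; rewrite /ext_T altS.
- by move=> i j; rewrite /ext_S altS.
- by left.
- by move=> i j; rewrite /ext_T altS.
- by left.
Qed.

Section LNet.
Variable L : nat -> nat -> pt.
Hypothesis HL : is_L_net m n L.

Lemma L_face_ST i j : L_face m n i j ->
  quad_ST (L i j) (L i.+1 j) (L i.+1 j.+1) (L i j.+1) (L_face_S L i j) (L_face_T L i j).
Proof.
by move=> ij; rewrite /L_face_S /L_face_T ij; apply: convex_face_ST; exact: HL.
Qed.

Lemma L_face_S_gt0 i j : 0 < L_face_S L i j.
Proof.
case: (boolP (L_face m n i j)) => [/L_face_ST[] //|ij].
by rewrite /L_face_S (negPf ij).
Qed.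

Lemma L_face_T_gt0 i j : 0 < L_face_T L i j.
Proof.
case: (boolP (L_face m n i j)) => [/L_face_ST[] //|ij].
by rewrite /L_face_T (negPf ij).
Qed.

Lemma ext_S_gt0 b i j : 0 < ext_S b L i j.
Proof. by rewrite /ext_S; case: b; rewrite ?alt_gt0 ?L_face_S_gt0. Qed.

Lemma ext_T_gt0 b i j : 0 < ext_T b L i j.
Proof. by rewrite /ext_T; case: b; rewrite ?alt_gt0 ?L_face_T_gt0. Qed.

Hypotheses (m0 : (0 < m)%N) (n0 : (0 < n)%N).

Lemma L_face0j j : L_face m n 0 j = (j < n)%N.
Proof. by rewrite /L_face eqxx m0 andbT; case: j => [|j]; rewrite ?n0 ?orbF. Qed.

Lemma L_facei0 i : L_face m n i 0 = (i < m)%N.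
Proof. by rewrite /L_face eqxx n0 andbT; case: i => [|i]; rewrite ?m0 ?orbF. Qed.

Lemma alternate_ext_S :
  (forall j, (j.+1 < n)%N -> L_face_S L 0 j.+1 = (L_face_S L 0 j)^-1) ->
  forall i j, L_face m n i j -> ext_S true L i j = L_face_S L i j.
Proof.
move=> SV i j; rewrite /L_face => /orP[/andP[/eqP-> jn]|/andP[/eqP-> _]] //.
elim: j jn => [//|j IH] jn; rewrite /ext_S altS SV //.
by have := IH (ltnW jn); rewrite /ext_S => ->.
Qed.

Lemma alternate_ext_T :
  (forall i, (i.+1 < m)%N -> L_face_T L i.+1 0 = (L_face_T L i 0)^-1) ->
  forall i j, L_face m n i j -> ext_T true L i j = L_face_T L i j.
Proof.
move=> TV i j; rewrite /L_face => /orP[/andP[/eqP-> jn]|/andP[/eqP-> im]] //.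
elim: i im => [//|i IH] im; rewrite /ext_T altS TV //.
by have := IH (ltnW im); rewrite /ext_T => ->.
Qed.

Lemma constant_ext_T :
  (forall j, (j.+1 < n)%N -> L_face_T L 0 j.+1 = L_face_T L 0 j) ->
  forall i j, L_face m n i j -> ext_T false L i j = L_face_T L i j.
Proof.
move=> TE i j; rewrite /L_face => /orP[/andP[/eqP-> jn]|/andP[/eqP-> im]] //.
by elim: j jn => [//|j IH] jn; rewrite TE // -IH // ltnW.
Qed.

Lemma constant_ext_S :
  (forall i, (i.+1 < m)%N -> L_face_S L i.+1 0 = L_face_S L i 0) ->
  forall i j, L_face m n i j -> ext_S false L i j = L_face_S L i j.
Proof.
move=> SE i j; rewrite /L_face => /orP[/andP[/eqP-> jn]|/andP[/eqP-> im]] //.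
by elim: i im => [//|i IH] im; rewrite SE // -IH // ltnW.
Qed.

(** Faces of a sub-net are compared from their common edge: the first is flipped, which inverts the
    parameter along that edge, and for a 2 x 1 sub-net the two parameters are swapped as well. *)
Lemma conditions_extend : cond_affine_symmetric m n L \/ cond_opposite_ratios m n L ->
  exists2 b, b.1 || b.2 & extends b L.
Proof.
have q12 j : (j.+1 < n)%N -> [/\ L_face m n 0 j, L_face m n 0 j.+1,
   quad_ST (L 0 j.+1) (L 1 j.+1) (L 1 j) (L 0 j) (L_face_S L 0 j)^-1 (L_face_T L 0 j)
  & quad_ST (L 0 j.+1) (L 1 j.+1) (L 1 j.+2) (L 0 j.+2)
      (L_face_S L 0 j.+1) (L_face_T L 0 j.+1)]%N.
  move=> jn; have f1 : L_face m n 0 j by rewrite L_face0j ltnW.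
  have f2 : L_face m n 0 j.+1 by rewrite L_face0j.
  by split=> //; [exact: quad_ST_flip (L_face_ST f1) | exact: L_face_ST f2].
have q21 i : (i.+1 < m)%N -> [/\ L_face m n i 0, L_face m n i.+1 0,
   quad_ST (L i.+1 0) (L i.+1 1) (L i 1) (L i 0) (L_face_T L i 0)^-1 (L_face_S L i 0)
  & quad_ST (L i.+1 0) (L i.+1 1) (L i.+2 1) (L i.+2 0)
      (L_face_T L i.+1 0) (L_face_S L i.+1 0)]%N.
  move=> im; have f1 : L_face m n i 0 by rewrite L_facei0 ltnW.
  have f2 : L_face m n i.+1 0 by rewrite L_facei0.
  split=> //; last exact: quad_ST_swap (L_face_ST f2).
  exact: quad_ST_flip (quad_ST_swap (L_face_ST f1)).
have inv2 (x y : R) : 0 < x -> 0 < y -> ((x^-1) ^+ 2)^-1 = (y ^+ 2)^-1 -> y = x^-1.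
  move=> x0 y0 /invr_inj /eqP; rewrite eqrXn2 ?invr_ge0 ?ltW // => /eqP->//.
case=> [[as12|as21]|[or12 or21]].
- exists (true, false) => // i j ij; split.
    apply: alternate_ext_S ij => {i} {}j jn; have [f1 f2 q1 q2] := q12 j jn.
    by have [] := affine_symmetric_ST q1 q2 (as12 _ _ f1 f2).
  apply: constant_ext_T ij => {i} {}j jn; have [f1 f2 q1 q2] := q12 j jn.
  by have [] := affine_symmetric_ST q1 q2 (as12 _ _ f1 f2).
- exists (false, true) => // i j ij; split.
    apply: constant_ext_S ij => {}i {j} im; have [f1 f2 q1 q2] := q21 i im.
    by have [] := affine_symmetric_ST q1 q2 (as21 _ _ f1 f2).
  apply: alternate_ext_T ij => {}i {j} im; have [f1 f2 q1 q2] := q21 i im.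
  by have [] := affine_symmetric_ST q1 q2 (as21 _ _ f1 f2).
- exists (true, true) => // i j ij; split.
    apply: alternate_ext_S ij => {i} {}j jn; have [f1 f2 q1 q2] := q12 j jn.
    apply: inv2; rewrite ?L_face_S_gt0 // -(opposite_ratioE q1) -(opposite_ratioE q2).
    exact: or12 f1 f2.
  apply: alternate_ext_T ij => {}i {j} im; have [f1 f2 q1 q2] := q21 i im.
  apply: inv2; rewrite ?L_face_T_gt0 // -(opposite_ratioE q1) -(opposite_ratioE q2).
  exact: or21 f1 f2.
Qed.

Variable b : bool * bool.
Hypotheses (b0 : b.1 || b.2) (bL : extends b L).
Let N := completion (ext_S b.1 L) (ext_T b.2 L) L.

Lemma completion_contains : L_contained m n L N.
Proof.
have step i j : L_face m n i j -> N i j = L i j -> N i.+1 j = L i.+1 j ->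
    N i j.+1 = L i j.+1 -> N i.+1 j.+1 = L i.+1 j.+1.
  move=> f e1 e2 e3; have [_ _ _ e] := L_face_ST f; have [SE TE] := bL f.
  by rewrite /N completionSS -/N e1 e2 e3 [in RHS]e SE TE.
have row1 j : (j <= n)%N -> N 1%N j = L 1%N j.
  elim: j => [//|j IH] jn; apply: step => //; first by rewrite L_face0j.
  exact: IH (ltnW jn).
have col1 i : (i <= m)%N -> N i 1%N = L i 1%N.
  elim: i => [//|i IH] im; apply: step; rewrite ?L_facei0 //.
  - exact: completioni0.
  - exact: IH (ltnW im).
move=> [|[|i]] [|[|j]] /andP[/andP[im jn] ij1] //; try exact: completioni0.
- exact: row1.
- exact: row1.
- exact: col1.
- by move: ij1; rewrite geq_min.
Qed.

Lemma completion_net_ST :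
  (forall i j, net_face m n i j -> 0 < gram (N i.+1 j - N i j) (N i j.+1 - N i j)) ->
  net_ST m n N (ext_S b.1 L) (ext_T b.2 L).
Proof.
by move=> g i j ij; split; rewrite ?ext_S_gt0 ?ext_T_gt0 ?g.
Qed.

Lemma completion_deformable :
  (forall i j, net_face m n i j -> 0 < gram (N i.+1 j - N i j) (N i j.+1 - N i j)) ->
  is_net m n N /\ deformable m n N.
Proof.
move=> /completion_net_ST q; split; first exact: net_ST_is_net q.
have [h [v [hv hc vc]]] := alternating_family_exists m0 n0 (ext_S_gt0 b.1)
  (ext_T_gt0 b.2) (ext_alternating L b0).
exact: scale_family_deformable hv hc vc.
Qed.

Lemma deformable_completion P : is_net m n P -> deformable m n P ->
  L_contained m n L P -> net_eq m n P N.
Proof.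
move=> Pnet Pdef LP.
pose S i j := on_face face_S P i j; pose T i j := on_face face_T P i j.
have q : net_ST m n P S T by move=> i j ij; apply: convex_face_ST; exact: Pnet.
have [h [v hv]] := deformable_scale_family m0 n0 q Pdef.
have face i j : (i < m)%N -> (j < n)%N -> net_face m n i j.
  by move=> im jn; rewrite /net_face im.
have [SL TL] : (forall i j, L_face m n i j -> S i j = L_face_S L i j) /\
               (forall i j, L_face m n i j -> T i j = L_face_T L i j).
  suff LE i j : L_face m n i j -> [/\ P i j = L i j, P i.+1 j = L i.+1 j,
      P i.+1 j.+1 = L i.+1 j.+1 & P i j.+1 = L i j.+1].
    split=> i j ij; have [e1 e2 e3 e4] := LE i j ij.
      by rewrite /S /L_face_S ij /on_face e1 e2 e3 e4.
    by rewrite /T /L_face_T ij /on_face e1 e2 e3 e4.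
  move=> ij; split; apply: LP; move: ij; rewrite /L_face /L_idx /net_idx;
    move: m0 n0; lia.
have ST i j : (i < m)%N -> (j < n)%N -> S i j = ext_S b.1 L i j /\ T i j = ext_T b.2 L i j.
  apply: (alternating_family_unique (ext_S_gt0 b.1) (ext_T_gt0 b.2) _ _
    (ext_alternating L b0) hv).
  - by move=> k l km ln; have [] := q k l (face k l km ln).
  - by move=> k l km ln; have [] := q k l (face k l km ln).
  - by move=> k l kl; rewrite SL // TL //; have [-> ->] := bL kl.
apply: completion_unique.
- by move=> i im; apply: LP; rewrite /L_idx /net_idx minn0 im.
- by move=> j jn; apply: LP; rewrite /L_idx /net_idx min0n jn.
- move=> i j im jn; have [_ _ _ e] := q i j (face i j im jn).
  by have [<- <-] := ST i j im jn.
Qed.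

End LNet.
End Completion.

(** * L-shaped square nets *)

Section SquareNets.
Context {R : realType} {d : nat}.
Local Notation pt := 'rV[R]_d.

Lemma gram_neq0 (e f : pt) : 0 < gram e f -> dot e e != 0.
Proof.
by apply: contraTneq => ee; rewrite /gram ee mul0r sub0r oppr_gt0 -leNgt sqr_ge0.
Qed.

Lemma squareP (A B C D : pt) : square A B C D ->
  [/\ 0 < gram (B - A) (D - A), dot (B - A) (D - A) = 0 & C = A + (B - A) + (D - A)].
Proof.
case=> /convex_quadP[p [r [g p0 r0 pr CE]]] _ [h1 h2 _ h4].
have [CB CD _] := quad_frame CE.
have coef0 (e f : pt) (a b : R) : dot e f = 0 -> dot e e != 0 ->
    dot (a *: e + b *: f) (- e) = 0 -> a = 0.
  move=> ef ee; rewrite !dotE (dotC f e) ef mulr0 addr0 => /eqP.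
  by rewrite -mulrN mulf_eq0 oppr_eq0 (negPf ee) orbF => /eqP.
have p1 : p - 1 = 0.
  by apply: (coef0 _ _ _ r h1 (gram_neq0 g)); rewrite -CB opprB.
have r1 : r - 1 = 0.
  rewrite dotC in h1; rewrite gramC in g.
  by apply: (coef0 _ _ _ p h1 (gram_neq0 g)); rewrite addrC -CD opprB dotC.
split=> //; rewrite CE; move/eqP: p1; move/eqP: r1; rewrite !subr_eq0 => /eqP-> /eqP->.
by rewrite !scale1r.
Qed.

Lemma plane_coord (U : 'M[R]_(2, d)) (e f u : pt) : 0 < gram e f ->
  (e <= U)%MS -> (f <= U)%MS -> (u <= U)%MS -> exists x y : R, u = x *: e + y *: f.
Proof.
rewrite -row_free_gram => rf eU fU uU.
have sub : (col_mx e f <= U)%MS by rewrite col_mx_sub eU fU.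
have : (U <= col_mx e f)%MS.
  rewrite -(geq_leqif (mxrank_leqif_sup sub)) (eqP rf).
  exact: rank_leq_row.
move=> /(submx_trans uU)/submxP[z ->]; rewrite -[z]hsubmxK mul_row_col.
exists (lsubmx z 0 0), (rsubmx z 0 0).
by rewrite [lsubmx z]mx11_scalar [rsubmx z]mx11_scalar !mul_scalar_mx !mxE !mulr1n.
Qed.

Variables (m n : nat) (S : nat -> nat -> pt).
Hypotheses (m0 : (0 < m)%N) (n0 : (0 < n)%N) (HS : is_L_square_net m n S).

Lemma square_face_ST i j : L_face_S m n S i j = 1 /\ L_face_T m n S i j = 1.
Proof.
have [_ sq _ _] := HS; case: (boolP (L_face m n i j)) => ij; last first.
  by rewrite /L_face_S /L_face_T (negPf ij).
rewrite /L_face_S /L_face_T ij; apply: face_STE.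
have [g _ CE] := squareP (sq i j ij); split=> //.
by rewrite /pST /rST mulr1 mul1r divff // !scale1r.
Qed.

(** The two edges lie on different arms and will span face (i, j) of the completed square net. The
    first is orthogonal to the common edge vector [f] of its arm, the second to [e]; in the plane of
    [e] and [f] the second is a multiple of [f], so the two are orthogonal. *)
Lemma square_edges i j : (i < m)%N -> (j < n)%N ->
  0 < gram (S i.+1 0%N - S i 0%N) (S 0%N j.+1 - S 0%N j).
Proof.
move=> im jn; have [_ sq [Z [U SU]] _] := HS.
have inU k l k' l' : L_idx m n k l -> L_idx m n k' l' -> (S k l - S k' l' <= U)%MS.
  move=> kl kl'; have -> : S k l - S k' l' = (S k l - Z) - (S k' l' - Z).
    by rewrite opprB addrA subrK.
  by rewrite addmx_sub ?eqmx_opp ?SU.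
have col0 k : (k <= m)%N -> L_idx m n k 0 by move=> km; rewrite /L_idx /net_idx km minn0.
have row0 k : (k <= n)%N -> L_idx m n 0 k by move=> kn; rewrite /L_idx /net_idx kn min0n.
have sqST k l : L_face m n k l -> [/\ 0 < gram (S k.+1 l - S k l) (S k l.+1 - S k l),
    dot (S k.+1 l - S k l) (S k l.+1 - S k l) = 0
    & S k.+1 l.+1 = S k l + (S k.+1 l - S k l) + (S k l.+1 - S k l)].
  by move=> kl; exact: squareP (sq k l kl).
pose e := S 1%N 0%N - S 0%N 0%N; pose f := S 0%N 1%N - S 0%N 0%N.
have rowE k : (k <= n)%N -> S 1%N k - S 0%N k = e.
  elim: k => [//|k IH] kn; have fk : L_face m n 0 k by rewrite L_face0j.
  have [_ _ ->] := sqST _ _ fk; rewrite -(IH (ltnW kn)).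
  by apply/rowP => l; rewrite !mxE; ring.
have colE k : (k <= m)%N -> S k 1%N - S k 0%N = f.
  elim: k => [//|k IH] km; have fk : L_face m n k 0 by rewrite L_facei0.
  have [_ _ ->] := sqST _ _ fk; rewrite -(IH (ltnW km)).
  by apply/rowP => l; rewrite !mxE; ring.
have fi : L_face m n i 0 by rewrite L_facei0.
have fj : L_face m n 0 j by rewrite L_face0j.
have f0 : L_face m n 0 0 by rewrite L_face0j.
have [g oef _] := sqST _ _ f0; rewrite -/e -/f in g oef.
have [gi oi _] := sqST _ _ fi; rewrite colE ?(ltnW im) // in gi oi.
have [gj oj _] := sqST _ _ fj; rewrite rowE ?(ltnW jn) // in gj oj.
set ei := S i.+1 _ - _ in gi oi *; set fj' := S _ j.+1 - _ in gj oj *.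
have eU : (e <= U)%MS by apply: inU; rewrite ?row0 ?col0.
have fU : (f <= U)%MS by apply: inU; rewrite ?row0 ?col0.
have fjU : (fj' <= U)%MS by apply: inU; rewrite ?row0 // ltnW.
have [x [y fjE]] := plane_coord g eU fU fjU.
clearbody e f ei fj'.
have ee : dot e e != 0 by exact: gram_neq0 g.
have x0 : x = 0.
  move: oj; rewrite fjE !dotE oef mulr0 addr0 => /eqP.
  by rewrite mulf_eq0 (negPf ee) orbF => /eqP.
have : dot ei fj' = 0 by rewrite fjE x0 scale0r add0r dotE oi mulr0.
rewrite /gram => ->; rewrite expr0n subr0 mulr_gt0 // lt_def dot_ge0 andbT.
  exact: gram_neq0 gi.
by apply: (@gram_neq0 fj' e); rewrite gramC.
Qed.

End SquareNets.

(** * Continuity *)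

Section LNetTopology.
Context {R : realType} {d : nat}.
Local Notation pt := 'rV[R]_d.
Local Notation nets := (nat -> nat -> pt).
Variables m n : nat.

(** A filter that controls only the vertices of the L-shape, since other values of a net are
    meaningless; it puts [L_close] within reach of limit arguments. *)
Definition L_nbhs (L0 : nets) : set_system nets :=
  filter_from [set r : R | 0 < r] (fun r => [set L | L_close m n r L L0]).

Global Instance L_nbhs_filter (L0 : nets) : Filter (L_nbhs L0).
Proof.
apply: filter_from_filter; first by exists 1; exact: ltr01.
move=> r s r0 s0; exists (Num.min r s); first by rewrite /= lt_min r0 s0.
by move=> L LL; split=> i j ij; move: (LL i j ij); rewrite lt_min => /andP[].
Qed.

Hypotheses (m0 : (0 < m)%N) (n0 : (0 < n)%N).
Variable L0 : nets.
Hypothesis HL0 : is_L_net m n L0.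

Lemma cvg_L_vertex i j : L_idx m n i j -> L i j @[L --> L_nbhs L0] --> L0 i j.
Proof.
move=> ij; apply/cvgrPdist_lt => e e0; exists e => // L LL.
by rewrite distrC; exact: LL.
Qed.

Lemma cvg_L_face i j : L_face_S m n L i j @[L --> L_nbhs L0] --> L_face_S m n L0 i j /\
  L_face_T m n L i j @[L --> L_nbhs L0] --> L_face_T m n L0 i j.
Proof.
rewrite /L_face_S /L_face_T; case: ifPn => ij; last by split; exact: cvg_cst.
have q := L_face_ST HL0 ij.
have idx : [/\ L_idx m n i j, L_idx m n i.+1 j, L_idx m n i.+1 j.+1 & L_idx m n i j.+1].
  by move: ij m0 n0; rewrite /L_face /L_idx /net_idx; split; lia.
have [i1 i2 i3 i4] := idx.
exact: (cvg_face_ST q (cvg_L_vertex i1) (cvg_L_vertex i2) (cvg_L_vertex i3)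
  (cvg_L_vertex i4)).
Qed.

Lemma cvg_alt k (f : nets -> R) (a : R) : a != 0 -> f @ L_nbhs L0 --> a ->
  alt k (f L) @[L --> L_nbhs L0] --> alt k a.
Proof. by move=> a0 fa; rewrite /alt; case: (odd k) => //; exact: cvgV. Qed.

Lemma cvg_ext_S b i j : ext_S m n b L i j @[L --> L_nbhs L0] --> ext_S m n b L0 i j.
Proof.
rewrite /ext_S; case: b; last by have [] := cvg_L_face 0 j.
by apply: cvg_alt; [rewrite gt_eqF // L_face_S_gt0 | have [] := cvg_L_face i 0].
Qed.

Lemma cvg_ext_T b i j : ext_T m n b L i j @[L --> L_nbhs L0] --> ext_T m n b L0 i j.
Proof.
rewrite /ext_T; case: b; last by have [] := cvg_L_face i 0.
by apply: cvg_alt; [rewrite gt_eqF // L_face_T_gt0 | have [] := cvg_L_face 0 j].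
Qed.

Definition extended_net (b : bool * bool) (L : nets) : nets :=
  completion (ext_S m n b.1 L) (ext_T m n b.2 L) L.

Lemma cvg_extended_net b i j : net_idx m n i j ->
  extended_net b L i j @[L --> L_nbhs L0] --> extended_net b L0 i j.
Proof.
move=> /andP[]; elim: i j => [|i IHi] j.
  by move=> _ jn; apply: cvg_L_vertex; rewrite /L_idx /net_idx jn min0n.
move=> im; elim: j => [_|j IHj jn].
  by apply: cvg_L_vertex; rewrite /L_idx /net_idx im.
have cA := IHi j (ltnW im) (ltnW jn); have cB := IHj (ltnW jn).
have cD := IHi j.+1 (ltnW im) jn.
have cS := @cvg_ext_S b.1 i j; have cT := @cvg_ext_T b.2 i j.
have S0 := ext_S_gt0 HL0 b.1 i j; have T0 := ext_T_gt0 HL0 b.2 i j.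
have cST : (ext_S m n b.1 L i j + ext_T m n b.2 L i j)^-1 @[L --> L_nbhs L0] -->
    (ext_S m n b.1 L0 i j + ext_T m n b.2 L0 i j)^-1.
  by apply: cvgV; [rewrite gt_eqF ?addr_gt0 | exact: cvgD].
have c1 : 1 + ext_S m n b.1 L i j * ext_T m n b.2 L i j @[L --> L_nbhs L0] -->
    1 + ext_S m n b.1 L0 i j * ext_T m n b.2 L0 i j.
  by apply: cvgD; [exact: cvg_cst | exact: cvgM].
apply: cvgD; first apply: cvgD => //.
  by apply: cvgZ; [apply: cvgM => //; exact: cvgM | exact: cvgB].
by apply: cvgZ; [apply: cvgM => //; exact: cvgM | exact: cvgB].
Qed.

(** A mode is applicable on a closed set, so nets near [L0] use only modes already applicable to
    [L0]. *)
Lemma near_not_extends b : ~ extends m n b L0 ->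
  \forall L \near L_nbhs L0, ~ extends m n b L.
Proof.
move=> /existsNP[i /existsNP[j /not_implyP[ij]]] /not_andP ne.
have [cS cT] := cvg_L_face i j.
case: ne => /eqP; rewrite -subr_eq0 => ne.
  have : \forall L \near L_nbhs L0, ext_S m n b.1 L i j - L_face_S m n L i j != 0.
    exact: (cvgr_neq0 _ (cvgB (@cvg_ext_S b.1 i j) cS) ne).
  by apply: filterS => L; rewrite /= subr_eq0 => /eqP neL /(_ i j ij)[].
have : \forall L \near L_nbhs L0, ext_T m n b.2 L i j - L_face_T m n L i j != 0.
  exact: (cvgr_neq0 _ (cvgB (@cvg_ext_T b.2 i j) cT) ne).
by apply: filterS => L; rewrite /= subr_eq0 => /eqP neL /(_ i j ij)[].
Qed.

Lemma near_net_close b (e : R) : 0 < e ->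
  \forall L \near L_nbhs L0, net_close m n e (extended_net b L) (extended_net b L0).
Proof.
move=> e0.
have : \forall L \near L_nbhs L0, forall (i : 'I_m.+1) (j : 'I_n.+1),
    `|extended_net b L i j - extended_net b L0 i j| < e.
  apply: (@filter_forall _ _ (fun (i : 'I_m.+1) L => forall j : 'I_n.+1,
    `|extended_net b L i j - extended_net b L0 i j| < e)) => i.
  apply: (@filter_forall _ _ (fun (j : 'I_n.+1) L =>
    `|extended_net b L i j - extended_net b L0 i j| < e)) => j.
  have ij : net_idx m n i j by rewrite /net_idx -ltnS ltn_ord -ltnS ltn_ord.
  have /cvgrPdist_lt /(_ e e0) := @cvg_extended_net b i j ij.
  by apply: filterS => L; rewrite distrC.
apply: filterS => L H i j /andP[im jn].
exact: (H (Ordinal (im : (i < m.+1)%N)) (Ordinal (jn : (j < n.+1)%N))).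
Qed.

End LNetTopology.

Lemma near_square_net_gram (R : realType) (d m n : nat) (S : nat -> nat -> 'rV[R]_d) :
  (0 < m)%N -> (0 < n)%N -> is_L_square_net m n S -> forall b,
  \forall L \near L_nbhs m n S, forall i j, net_face m n i j ->
    let N := extended_net m n b L in 0 < gram (N i.+1 j - N i j) (N i j.+1 - N i j).
Proof.
move=> m0 n0 HS b.
have [HL _ _ _] := HS.
(* All parameters of the square net are 1, so in every mode its completion is a net of
   parallelograms spanned by the edges of the two arms. *)
have E i j : extended_net m n b S i j = S i 0%N + (S 0%N j - S 0%N 0%N).
  elim: i j => [|i IHi] j; first by rewrite /extended_net completion0j addrC subrK.
  elim: j => [|j IHj]; first by rewrite /extended_net completioni0 subrr addr0.
  rewrite /extended_net completionSS -/(extended_net m n b S) IHj !IHi.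
  have -> : ext_S m n b.1 S i j = 1.
    by rewrite /ext_S /alt; do !case: ifP => _; rewrite (square_face_ST HS _ _).1 ?invr1.
  have -> : ext_T m n b.2 S i j = 1.
    by rewrite /ext_T /alt; do !case: ifP => _; rewrite (square_face_ST HS _ _).2 ?invr1.
  rewrite /fourth_vertex /pST /rST mulr1 mul1r divff // !scale1r.
  by apply/rowP => k; rewrite !mxE; ring.
have G (i : 'I_m) (j : 'I_n) : \forall L \near L_nbhs m n S,
    let N := extended_net m n b L in 0 < gram (N i.+1 j - N i j) (N i j.+1 - N i j).
  have im := ltn_ord i; have jn := ltn_ord j.
  have c k l : (k <= m)%N -> (l <= n)%N ->
      extended_net m n b L k l @[L --> L_nbhs m n S] --> extended_net m n b S k l.
    by move=> km ln; apply: cvg_extended_net => //; rewrite /net_idx km.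
  have cg : gram (extended_net m n b L i.+1 j - extended_net m n b L i j)
      (extended_net m n b L i j.+1 - extended_net m n b L i j) @[L --> L_nbhs m n S] -->
      gram (S i.+1 0%N - S i 0%N) (S 0%N j.+1 - S 0%N j).
    have -> : S i.+1 0%N - S i 0%N = extended_net m n b S i.+1 j - extended_net m n b S i j.
      by rewrite !E; apply/rowP => k; rewrite !mxE; ring.
    have -> : S 0%N j.+1 - S 0%N j = extended_net m n b S i j.+1 - extended_net m n b S i j.
      by rewrite !E; apply/rowP => k; rewrite !mxE; ring.
    by apply: cvg_gram; apply: cvgB; apply: c => //; exact: ltnW.
  exact: (cvgr_gt _ cg _ (square_edges m0 n0 HS im jn)).
have : \forall L \near L_nbhs m n S, forall (i : 'I_m) (j : 'I_n),
    let N := extended_net m n b L in 0 < gram (N i.+1 j - N i j) (N i j.+1 - N i j).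
  apply: (@filter_forall _ _ (fun (i : 'I_m) L => forall j : 'I_n,
    let N := extended_net m n b L in
    0 < gram (N i.+1 j - N i j) (N i j.+1 - N i j))) => i.
  by apply: (@filter_forall _ _ (fun (j : 'I_n) L =>
    let N := extended_net m n b L in
    0 < gram (N i.+1 j - N i j) (N i j.+1 - N i j))) => j; exact: G.
apply: filterS => L H i j /andP[im jn].
exact: (H (Ordinal im) (Ordinal jn)).
Qed.

Theorem corollary3p2 (R : realType) (d m n : nat)
    (hm : (0 < m)%N) (hn : (0 < n)%N)
    (S : nat -> nat -> 'rV[R]_d) (hS : is_L_square_net m n S) :
  exists2 eps : R, 0 < eps &
    let X := [set L : nat -> nat -> 'rV[R]_d |
      [/\ is_L_net m n L, L_close m n eps L S
        & cond_affine_symmetric m n L \/ cond_opposite_ratios m n L]] in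
    exists Phi : (nat -> nat -> 'rV[R]_d) -> nat -> nat -> 'rV[R]_d,
      (forall L, X L ->
        [/\ is_net m n (Phi L), deformable m n (Phi L),
            L_contained m n L (Phi L)
          & forall P, is_net m n P -> deformable m n P ->
              L_contained m n L P -> net_eq m n P (Phi L)]) /\
      continuous_on_L_nets m n X Phi.
Proof.
have [eps /= eps0 gramS] : \forall L \near L_nbhs m n S, forall (b : bool * bool) i j,
    net_face m n i j -> let N := extended_net m n b L in
    0 < gram (N i.+1 j - N i j) (N i j.+1 - N i j).
  apply: (@filter_forall _ _ (fun (b : bool * bool) L => forall i j,
    net_face m n i j -> let N := extended_net m n b L in
    0 < gram (N i.+1 j - N i j) (N i j.+1 - N i j))) => b.
  exact: near_square_net_gram.
exists eps => //.
pose X := [set L : nat -> nat -> 'rV[R]_d |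
  [/\ is_L_net m n L, L_close m n eps L S
    & cond_affine_symmetric m n L \/ cond_opposite_ratios m n L]].
(* Several modes may apply to one net and any of them is picked; on [X] one always exists, so the
   fallback [L] in [Phi] is never reached there. *)
pose mode (L : nat -> nat -> 'rV[R]_d) :=
  [pick b : bool * bool | (b.1 || b.2) && `[< extends m n b L >]].
pose Phi L := if mode L is Some b then extended_net m n b L else L.
have unique b L : X L -> b.1 || b.2 -> extends m n b L ->
    [/\ is_net m n (extended_net m n b L), deformable m n (extended_net m n b L),
        L_contained m n L (extended_net m n b L)
      & forall P, is_net m n P -> deformable m n P ->
          L_contained m n L P -> net_eq m n P (extended_net m n b L)].
  move=> [HL Lc _] b0 bL.
  have [Nnet Ndef] := completion_deformable HL hm hn b0 (gramS L Lc b).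
  split=> //; first exact: completion_contains.
  by move=> P Pnet Pdef LP; exact: deformable_completion Pnet Pdef LP.
have modeP L : X L -> exists2 b, [/\ mode L = Some b, b.1 || b.2 & extends m n b L]
    & Phi L = extended_net m n b L.
  move=> XL; rewrite /Phi /mode; case: pickP => [b /andP[b0 /asboolP bL]|no].
    by exists b.
  have [HL _ cond] := XL; have [b b0 bL] := conditions_extend HL hm hn cond.
  by have := no b; rewrite b0 /=; move/asboolP.
exists Phi; split=> [L XL|L0 X0 e e0].
  by have [b [_ b0 bL] ->] := modeP L XL; exact: unique.
have [HL0 _ _] := X0.
have [r r0 Hr] : \forall L \near L_nbhs m n L0, forall b : bool * bool, X L ->
    b.1 || b.2 -> extends m n b L -> net_close m n e (extended_net m n b L) (Phi L0).
  apply: (@filter_forall _ _ (fun (b : bool * bool) L => X L ->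
    b.1 || b.2 -> extends m n b L ->
    net_close m n e (extended_net m n b L) (Phi L0))) => b.
  have [bL0|nb] := pselect (extends m n b L0); last first.
    by have := near_not_extends hm hn HL0 nb; apply: filterS => L nbL _ _ /nbL.
  have [b0|nb0] := boolP (b.1 || b.2); last by apply: nearW.
  have := near_net_close hm hn HL0 b e0; apply: filterS => L cl _ _ _ i j ij.
  (* The mode [b'] picked for [L0] may differ from [b], but both apply to [L0], and uniqueness of
     the deformable net identifies the two completions. *)
  have [b' [_ b0' bL0'] ->] := modeP L0 X0.
  have [_ _ _ u] := unique b' L0 X0 b0' bL0'.
  have [Nn Nd Nc _] := unique b L0 X0 b0 bL0.
  by rewrite -(u _ Nn Nd Nc i j ij); exact: cl.
exists r => // L XL LL0; have [b [_ b0 bL] ->] := modeP L XL.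
exact: Hr.
Qed.
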